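(* Let $\lambda>0$ be a real number. (i) Let $r\ge 1$ be an integer, let $\{G_n\}_{n\ge1}$ be a sequence of finite simple graphs with $|V(G_n)|\to\infty$, and let $c_n$ be positive integers with $c_n\to\infty$; the vertices of $G_n$ are colored uniformly at random with $c_n$ colors. Then $T(K_{1,r},G_n)$ converges in distribution to $\mathrm{Pois}(\lambda)$ if and only if $$\lim_{n\to\infty}\mathbb{E}\,T(K_{1,r},G_n)=\lambda\quad\text{and}\quad\lim_{n\to\infty}\mathrm{Var}\,T(K_{1,r},G_n)=\lambda.$$ (ii) If $H$ is a finite simple connected graph with $|V(H)|\ge 2$ that is not a star-graph, then there exist a sequence of finite simple graphs $\{G_n(H)\}_{n\ge1}$ with $|V(G_n(H))|\to\infty$ and positive integers $c_n\to\infty$ such that, when the vertices of $G_n(H)$ are colored uniformly at random with $c_n$ colors, $T(H,G_n(H))$ converges in distribution to $\mathrm{Pois}(\lambda)$, but it is not the case that both $\lim_{n\to\infty}\mathbb{E}\,T(H,G_n(H))=\lambda$ and $\lim_{n\to\infty}\mathrm{Var}\,T(H,G_n(H))=\lambda$.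
   Context: $K_{1,r}$ is the star with one central vertex joined to $r$ leaves; a star-graph is a graph isomorphic to $K_{1,r}$ for some integer $r\ge 1$. In a uniformly random $c_n$-coloring of $G_n$, the vertices $v\in V(G_n)$ receive independent colors $X_v$, each uniform on $\{1,\dots,c_n\}$. For a finite simple connected graph $H$ with $V(H)=\{1,\dots,|V(H)|\}$ and with $(a_{ij}(G_n))$ the adjacency matrix of $G_n$, define $$T(H,G_n)=\frac{1}{|Aut(H)|}\sum_{\boldsymbol s}\ \prod_{(a,b)\in E(H)}a_{s_as_b}(G_n)\,\mathbf 1\{X_{s_1}=\cdots=X_{s_{|V(H)|}}\},$$ the sum being over all tuples $\boldsymbol s=(s_1,\dots,s_{|V(H)|})$ of distinct vertices of $G_n$. Thus $T(H,G_n)$ is the number of monochromatic copies of $H$ (subgraphs of $G_n$ isomorphic to $H$, not necessarily induced). *)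

(* Defs.v *)
From HB Require Import structures.
From mathcomp Require Export all_boot all_order all_algebra all_fingroup.
From mathcomp Require Import finmap.
From mathcomp Require Export all_classical all_reals all_analysis.

Set Implicit Arguments.
Unset Strict Implicit.
Unset Printing Implicit Defensive.

Import Order.TTheory GRing.Theory Num.Theory.
Import numFieldNormedType.Exports.

Local Open Scope classical_set_scope.
Local Open Scope ring_scope.

Record sgraph := SGraph {
  vertex :> finType;
  adj : rel vertex;
  adj_sym : symmetric adj;
  adj_irrefl : irreflexive adj }.

Definition connected_graph (G : sgraph) : Prop :=
  forall x y : G, connect (@adj G) x y.

Definition graph_iso (G G' : sgraph) : Prop :=
  exists2 f : G -> G', bijective f & forall x y, adj (f x) (f y) = adj x y.

(* In 'I_r.+1 the central vertex is 0 and the leaves are 1, ..., r. *)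
Definition star_adj (r : nat) : rel 'I_r.+1 :=
  fun i j => (i == ord0) != (j == ord0).

Lemma star_adj_sym r : symmetric (@star_adj r).
Proof. by move=> i j; rewrite /star_adj eq_sym. Qed.

Lemma star_adj_irrefl r : irreflexive (@star_adj r).
Proof. by move=> i; rewrite /star_adj eqxx. Qed.

Definition star (r : nat) : sgraph :=
  SGraph (@star_adj_sym r) (@star_adj_irrefl r).

Definition is_star (H : sgraph) : Prop :=
  exists2 r : nat, (1 <= r)%N & graph_iso H (star r).

Definition automorphisms (H : sgraph) : {set {perm H}} :=
  [set g : {perm H} | [forall a, forall b, adj (g a) (g b) == adj a b]].

(* The type of colors is 'I_c.-1.+1, which has exactly c elements when c > 0;
   the successor makes it inhabited for every c, as a sample space must be. *)
Definition coloring (G : sgraph) (c : nat) : Type := {ffun G -> 'I_c.-1.+1}.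

Section coloring_measurable.
Variables (G : sgraph) (c : nat).

HB.instance Definition _ := Finite.on (coloring G c).
HB.instance Definition _ := isPointed.Build (coloring G c) [ffun=> ord0].
HB.instance Definition _ := @isMeasurable.Build default_measure_display
  (coloring G c) discrete_measurable discrete_measurable0
  discrete_measurableC discrete_measurableU.

End coloring_measurable.

(* Uniform law on the finite set of all colorings. The point mass is only the
   default value of mnormalize, used when the total mass is 0 or +oo, which does
   not happen here. Lemma uniform_coloring_iid below shows that under this law
   the colors are independent and uniform. *)
Definition uniform_coloring (R : realType) (G : sgraph) (c : nat) :
    probability (coloring G c) R :=
  mnormalize (@counting (coloring G c) R) (dirac (point : coloring G c)).

(* Each edge of H is listed once, as the pair (a, b) whose first end comes first
   in the enumeration of the vertices. *)
Definition mono_copies (R : realType) (H G : sgraph) (c : nat)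
    (X : coloring G c) : R :=
  #|automorphisms H|%:R^-1 *
  \sum_(s : {ffun H -> G} | injectiveb s)
    (\prod_(e : H * H | adj e.1 e.2 && (enum_rank e.1 < enum_rank e.2)%N)
       (adj (s e.1) (s e.2))%:R) *
    [forall a, forall b, X (s a) == X (s b)]%:R.

Section mono_copies_rv.
Variables (R : realType) (H G : sgraph) (c : nat).

Let measurable_mono_copies :
  measurable_fun [set: coloring G c] (@mono_copies R H G c).
Proof. by []. Qed.

HB.instance Definition _ := isMeasurableFun.Build _ _ _ _
  (@mono_copies R H G c) measurable_mono_copies.

End mono_copies_rv.

Definition mono_copies_rv (R : realType) (H G : sgraph) (c : nat) :
  {RV (uniform_coloring R G c) >-> R} := @mono_copies R H G c.

Definition nat_real (R : realType) (k : nat) : R := k%:R.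

Section nat_real_rv.
Variable R : realType.

Let measurable_nat_real : measurable_fun [set: nat] (@nat_real R).
Proof. by []. Qed.

HB.instance Definition _ := isMeasurableFun.Build _ _ _ _
  (@nat_real R) measurable_nat_real.

End nat_real_rv.

(* A real random variable of law Pois(lambda); the second argument of
   poisson_prob is a dummy that does not occur in its body. *)
Definition poisson_rv (R : realType) (lambda : R) :
  {RV (poisson_prob lambda 0) >-> R} := @nat_real R.

(* Convergence of the distribution functions at each continuity point of the
   limiting distribution function. *)
Definition cvg_in_distribution (R : realType) (d : nat -> measure_display)
    (T : forall n, measurableType (d n)) (P : forall n, probability (T n) R)
    (X : forall n, {RV (P n) >-> R})
    (d' : measure_display) (T' : measurableType d') (Q : probability T' R)
    (Y : {RV Q >-> R}) : Prop :=
  forall x : R, {for x, continuous (cdf Y)} ->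
    cdf (X n) x @[n --> \oo] --> cdf Y x.

Section uniform_coloring_facts.
Variables (R : realType) (G : sgraph) (c : nat).

Lemma uniform_coloringE (p : pred (coloring G c)) :
  uniform_coloring R G c [set X | p X] =
  (#|p|%:R / #|{: coloring G c}|%:R)%:E.
Proof.
have cE (q : pred (coloring G c)) :
    @counting (coloring G c) R [set X | q X] = (#|q|%:R)%:E.
  rewrite /counting asboolT; last exact: finite_finset.
  rewrite -card_finset; congr (_%:R)%:E; congr (#|` _|)%fset.
  apply/fsetP => X; rewrite in_fset_set; last exact: finite_finset.
  by rewrite !inE; apply/idP/idP; rewrite ?inE.
have cT : @counting (coloring G c) R [set: coloring G c] =
    (#|{: coloring G c}|%:R)%:E.
  have -> : [set: coloring G c] = [set X | predT X] by apply/seteqP; split.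
  by rewrite cE.
rewrite /uniform_coloring /= /mnormalize /= cT eqe orbF ifF; last first.
  apply/negbTE; rewrite pnatr_eq0 -lt0n.
  by apply/card_gt0P; exists point.
by rewrite cE.
Qed.

Lemma uniform_coloring_iid (B : {set G}) (x : coloring G c) : (0 < c)%N ->
  uniform_coloring R G c [set X | forall v, v \in B -> X v = x v] =
  (c%:R^-1 ^+ #|B|)%:E.
Proof.
move=> c0.
pose p : pred (coloring G c) := fun X => [forall (v | v \in B), X v == x v].
transitivity (uniform_coloring R G c [set X | p X]).
  congr (uniform_coloring R G c _); apply/seteqP; split => X /= h.
    by apply/forall_inP => v vB; apply/eqP/h.
  by move=> v vB; apply/eqP; move/forall_inP : h; apply.
rewrite uniform_coloringE.
pose F v : pred 'I_c.-1.+1 := if v \in B then pred1 (x v) else predT.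
have -> : #|p| = #|(family F : simpl_pred (coloring G c))|.
  apply: eq_card => X; apply/idP/familyP => [/forall_inP h v|h].
    by rewrite /F; case: ifPn => // vB; rewrite inE h.
  apply/forall_inP => v vB.
  by have := h v; rewrite /F vB inE.
rewrite card_family foldrE big_image/= (bigID (mem B))/=.
rewrite big1; last by move=> v vB; rewrite /F vB card1.
rewrite mul1n (eq_bigr (fun=> c)); last first.
  by move=> v vB; rewrite /F (negbTE vB) card_ord prednK.
rewrite prod_nat_const card_ffun card_ord prednK// exprVn.
have cn0 : c%:R != 0 :> R by rewrite pnatr_eq0 -lt0n.
rewrite -(cardC (mem B)) !natrX exprD; congr (_%:E).
by rewrite invfM mulrCA mulfV ?expf_neq0// mulr1.
Qed.

End uniform_coloring_facts.

(* Main.v *)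
Require Import Defs.
From mathcomp Require Import ring lra.

Set Implicit Arguments.
Unset Strict Implicit.
Unset Printing Implicit Defensive.

Import Order.TTheory GRing.Theory Num.Theory.
Import numFieldNormedType.Exports.

(** Write [T] for the number of monochromatic copies of [H], [X] for the random
    coloring with [c] colors, and [E] for expectation.  A count that satisfies
    [E (T h(T)) = E T * E h(T + 1)] up to a vanishing error, uniformly over
    functions [h] with values in the unit interval, has a Poisson limit as soon as
    its mean converges: for the indicator of [k + 1] this is the recursion
    [(k + 1) P(T = k + 1) = E T * P(T = k)], and the bounded mean prevents loss of
    mass ([poisson_recursion], [poisson_of_chen]).  To compare both sides, replace
    [T], given that a fixed copy is monochromatic, by one plus the number of
    monochromatic copies avoiding a set of its vertices that omits only one
    ([chen_bound], [family_chen]).  Whether a copy is monochromatic is independent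
    of all colors outside such a set.

    For stars with at least two leaves, the error consists of a term bounded by
    the sum of the covariances of distinct copies and of a term counting pairs of
    stars with a common vertex.  The first one is [Var T - E T] up to [o(1)].  It
    also controls the second one: all covariances are nonnegative, and stars that
    share their center and a leaf already contribute order
    [(degree / c) ^ (2r - 1)], so that all degrees are [o(c)] ([degree_excess],
    [star_chen_bound]).  For a single edge, degrees of order [c] are possible.
    There the set of vertices consists of the endpoint of smaller degree, and
    these smaller degrees are small on average ([sum_min_degree]).

    Conversely, if stars have a Poisson limit then [T = 0] keeps a positive
    probability.  A vertex of degree much larger than [c] would have [r] neighbors
    of its own color with high probability, so degrees are [O(c)]
    ([prob_no_star_degree]).  Under such a bound, conditioning on the colors of
    boundedly many vertices raises [E T] by a bounded amount only
    ([mean_times_copy_count]).  Hence the variance is at most a multiple of the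
    mean, the mean is bounded because [T = 0] is not unlikely, and then so is the
    third moment, which makes first and second moments converge
    ([stars_moments_cvg]).

    If [H] is connected and not a star, no single vertex covers its edges.  Take
    about [lambda * c ^ (#|H| - 1)] disjoint copies of [H], whose count is
    asymptotically Poisson, and add a clique on [#|H|] vertices joined to
    [c ^ #|H|] independent vertices.  A monochromatic copy in the added part needs
    two clique vertices of the same color ([embedding_core]), which has
    probability [O(1 / c)], and yet the added part makes the mean diverge
    ([gadget_seq_mean]). *)

Local Open Scope ring_scope.

(** * Averages over a finite set and Chen's bound *)

Lemma eq_ler (R : numDomainType) (x y : R) : x = y -> x <= y.
Proof. by move=> ->. Qed.

Section mean.
Variables (R : realType) (W : finType).
Implicit Types f g : W -> R.

Definition mean f : R := (\sum_w f w) / #|W|%:R.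

Lemma eq_mean f g : f =1 g -> mean f = mean g.
Proof. by move=> fg; rewrite /mean (eq_bigr g). Qed.

Lemma meanD f g : mean (fun w => f w + g w) = mean f + mean g.
Proof. by rewrite /mean big_split/= mulrDl. Qed.

Lemma meanZ a f : mean (fun w => a * f w) = a * mean f.
Proof. by rewrite /mean -mulr_sumr mulrA. Qed.

Lemma meanB f g : mean (fun w => f w - g w) = mean f - mean g.
Proof. by rewrite /mean big_split/= sumrN mulrBl. Qed.

Lemma mean_sum (J : Type) (s : seq J) (P : pred J) (F : J -> W -> R) :
  mean (fun w => \sum_(j <- s | P j) F j w) = \sum_(j <- s | P j) mean (F j).
Proof. by rewrite /mean exchange_big/= mulr_suml. Qed.

Lemma le_mean f g : (forall w, f w <= g w) -> mean f <= mean g.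
Proof.
by move=> fg; rewrite /mean ler_wpM2r ?invr_ge0// ler_sum.
Qed.

Lemma mean_ge0 f : (forall w, 0 <= f w) -> 0 <= mean f.
Proof. by move=> f0; rewrite mulr_ge0// ?invr_ge0// sumr_ge0. Qed.

Lemma norm_mean f : `|mean f| <= mean (fun w => `|f w|).
Proof.
rewrite normrM [X in _ * X]ger0_norm ?invr_ge0//.
by rewrite ler_wpM2r ?invr_ge0// ler_norm_sum.
Qed.

Lemma mean_cst (w0 : W) a : mean (fun=> a) = a.
Proof.
rewrite /mean sumr_const -[a *+ _]mulr_natr mulfK// pnatr_eq0 -lt0n.
by apply/card_gt0P; exists w0.
Qed.

Lemma mean_sqr_dev (w0 : W) f :
  mean (fun w => (f w - mean f) ^+ 2) = mean (fun w => f w ^+ 2) - mean f ^+ 2.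
Proof.
transitivity (mean (fun w => f w ^+ 2 + (- (2 * mean f) * f w + mean f ^+ 2))).
  by apply: eq_mean => w; ring.
by rewrite meanD meanD meanZ (mean_cst w0); ring.
Qed.

End mean.

Section chen.
Variables (R : realType) (W : finType) (I : finType) (S : {set I}).
Variables (A : I -> pred W) (near : rel I).

Let T w : nat := \sum_(i in S) A i w.
Let F i w : nat := \sum_(j in S | ~~ near i j) A j w.

Hypothesis near_refl : {in S, forall i, near i i}.
Hypothesis far_uncorrelated : {in S, forall i (g : nat -> R),
  mean (fun w => (A i w)%:R * g (F i w)) =
  mean (fun w => (A i w)%:R : R) * mean (fun w => g (F i w))}.

(** On the event [A i], replace the count [T] by one plus the count [F i] over the
    indices far from [i], which is independent of [A i]; undoing the replacement
    without [A i] gives the average of [h (T + 1)].  The first replacement errs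
    only if another near event occurs, the second only if some near event does. *)
Lemma chen_bound (h : nat -> R) : (forall k, 0 <= h k <= 1) ->
  `|mean (fun w => (T w)%:R * h (T w)) -
    mean (fun w => (T w)%:R : R) * mean (fun w => h (T w).+1)| <=
  \sum_(i in S) (\sum_(j in S | near i j && (j != i))
                    mean (fun w => (A i w)%:R * (A j w)%:R : R) +
                 \sum_(j in S | near i j)
                    mean (fun w => (A i w)%:R : R) *
                    mean (fun w => (A j w)%:R : R)).
Proof.
move=> h01.
have Tnear i w : T w = (F i w + \sum_(j in S | near i j) A j w)%N.
  by rewrite /T (bigID (near i))/= addnC.
have hdiff k l : `|h k - h l| <= 1.
  by rewrite ler_norml; have /andP[? ?] := h01 k; have /andP[? ?] := h01 l; lra.
have hcount k n : `|h (k + n)%N - h k| <= n%:R.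
  case: n => [|n]; first by rewrite addn0 subrr normr0.
  by rewrite (le_trans (hdiff _ _))// ler1n.
have -> : mean (fun w => (T w)%:R * h (T w)) =
    \sum_(i in S) mean (fun w => (A i w)%:R * h (T w)).
  rewrite -mean_sum; apply: eq_mean => w.
  by rewrite /T natr_sum mulr_suml.
have -> : mean (fun w => (T w)%:R : R) =
    \sum_(i in S) mean (fun w => (A i w)%:R : R).
  by rewrite -mean_sum; apply: eq_mean => w; rewrite /T natr_sum.
rewrite mulr_suml -sumrB (le_trans (ler_norm_sum _ _ _))// ler_sum// => i iS.
set p := mean (fun w => (A i w)%:R).
have p0 : 0 <= p by apply: mean_ge0 => w.
have -> : mean (fun w => (A i w)%:R * h (T w)) - p * mean (fun w => h (T w).+1) =
    mean (fun w => (A i w)%:R * (h (T w) - h (F i w).+1)) -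
    p * mean (fun w => h (T w).+1 - h (F i w).+1).
  rewrite meanB mulrBr -(far_uncorrelated iS (fun k => h k.+1)).
  under [in RHS]eq_mean do rewrite mulrBr.
  by rewrite meanB; ring.
rewrite (le_trans (ler_normB _ _))// lerD//.
- rewrite (le_trans (norm_mean _))// -mean_sum le_mean// => w.
  case Aiw: (A i w); last by rewrite mul0r normr0 sumr_ge0// => j _; rewrite mul0r.
  under eq_bigr do rewrite mul1r.
  rewrite mul1r -natr_sum (Tnear i w) (bigD1 i)/= ?iS ?near_refl// Aiw.
  rewrite addnA addn1.
  by under eq_bigl do rewrite -andbA; exact: hcount.
- rewrite normrM ger0_norm// -mulr_sumr ler_wpM2l//.
  rewrite (le_trans (norm_mean _))// -mean_sum le_mean// => w.
  by rewrite -natr_sum (Tnear i w) -addSn; exact: hcount.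
Qed.

End chen.

(** * Independent uniform colors *)

Section colors.
Variables (R : realType) (V C : finType).
Local Notation Om := {ffun V -> C}.
Implicit Types (U F : {set V}) (X Y : Om).

Definition depends_on (D : Type) U (Z : Om -> D) :=
  forall X Y, {in U, X =1 Y} -> Z X = Z Y.

Definition recolor X (x : V) (k : C) : Om :=
  [ffun y => if y == x then k else X y].

(** Exchanging the color of [x] with a fresh color is a bijection. *)
Lemma sum_recolor (f : Om -> R) x :
  \sum_X \sum_k f (recolor X x k) = #|C|%:R * \sum_X f X.
Proof.
rewrite pair_bigA/=.
pose swap (p : Om * C) := (recolor p.1 x p.2, p.1 x).
have swapK : involutive swap.
  move=> [X k]; rewrite /swap/= ffunE eqxx; congr pair.
  by apply/ffunP => y; rewrite !ffunE; case: eqP => [->|].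
rewrite (reindex_inj (inv_inj swapK))/=.
under eq_bigr => p _.
  have -> : recolor (recolor p.1 x p.2) x (p.1 x) = p.1.
    by apply/ffunP => y; rewrite !ffunE; case: eqP => [->|].
  over.
rewrite -(pair_bigA _ (fun X (_ : C) => f X))/= mulr_sumr.
by apply: eq_bigr => X _; rewrite sumr_const mulr_natl.
Qed.

Lemma mean_match1 U (Z : Om -> R) x u : depends_on U Z -> x \notin U ->
  u != x -> mean (fun X => Z X * (X x == X u)%:R) = mean Z / #|C|%:R.
Proof.
move=> UZ xU ux.
have [C0|C0] := eqVneq #|C| 0%N.
  have X0 (X : Om) : False by have := max_card (pred1 (X x)); rewrite card1 C0.
  rewrite /mean !big1 ?mul0r// => X; by have := X0 X.
have C0' : #|C|%:R != 0 :> R by rewrite pnatr_eq0.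
rewrite /mean -mulrA [_^-1 * _^-1]mulrC mulrA; congr (_ / _).
apply: (mulfI C0'); rewrite -(sum_recolor _ x) mulrCA mulfV// mulr1.
apply: eq_bigr => X _.
under eq_bigr => k _.
  have -> : Z (recolor X x k) = Z X.
    by apply: UZ => y yU; rewrite ffunE; case: eqP xU => // <-; rewrite yU.
  rewrite !ffunE eqxx (negbTE ux); over.
rewrite -mulr_sumr -natr_sum (bigD1 (X u))//= eqxx big1 ?addn0 ?mulr1// => k.
by move=> /negbTE ->.
Qed.

Definition matches F u X := [forall x in F, X x == X u].

(** Reveal the colors in [U] and at [u] before those in [F]: each color in [F] is
    fresh, and equals the color of [u] with probability [#|C|^-1]. *)
Lemma mean_matches U F (Z : Om -> R) u : depends_on U Z -> [disjoint F & U] ->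
  u \notin F ->
  mean (fun X => Z X * (matches F u X)%:R) = mean Z * #|C|%:R^-1 ^+ #|F|.
Proof.
move cF : #|F| => n; elim: n F cF U Z u => [|n IH] F0 cF U Z u UZ FU uF.
  rewrite expr0 mulr1; apply: eq_mean => X.
  suff -> : matches F0 u X by rewrite mulr1.
  by apply/forall_inP => x; rewrite (cards0_eq cF) inE.
have [x xF0] : exists x, x \in F0 by apply/card_gt0P; rewrite cF.
pose F := F0 :\ x.
have F0E : F0 = x |: F by rewrite finset.setD1K.
have xF : x \notin F by rewrite !inE eqxx.
have {}cF : #|F| = n by move: cF; rewrite (cardsD1 x) xF0 => -[].
move: FU uF; clearbody F; rewrite {}F0E => FU uF.
rewrite exprS mulrA.
move: uF; rewrite !inE negb_or => /andP[ux uF].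
have xU : x \notin U.
  by rewrite (disjointFr FU)// setU11.
have Z'dep : depends_on (x |: (u |: U)) (fun X => Z X * (X x == X u)%:R).
  move=> X Y XY; rewrite (XY x) ?(XY u) ?inE ?eqxx ?orbT//.
  by rewrite (UZ X Y)// => y yU; rewrite XY// !inE yU !orbT.
have FU2 : [disjoint F & x |: (u |: U)].
  apply/pred0P => y; apply/negP => /andP[/= yF].
  rewrite !inE => /or3P[/eqP yx|/eqP yu|yU]; [by rewrite -yx yF in xF| |].
    by rewrite -yu yF in uF.
  by have := disjointFr FU (setU1r x yF); rewrite yU.
rewrite -(@mean_match1 U Z x u)// -(IH _ cF _ _ _ Z'dep FU2 uF).
apply: eq_mean => X; rewrite -mulrA -natrM mulnb; congr (_ * (_ : bool)%:R).
apply/forall_inP/andP => [h|[/eqP xu /forall_inP h] y].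
  split; first by rewrite h// setU11.
  by apply/forall_inP => y yF; rewrite h// setU1r.
by rewrite !inE => /orP[/eqP ->|/h//]; rewrite xu.
Qed.

Definition monochromatic (I : finType) (s : I -> V) X :=
  [forall a, forall b, X (s a) == X (s b)].

Lemma monochromaticP (I : finType) (s : I -> V) X :
  reflect (forall a b, X (s a) = X (s b)) (monochromatic s X).
Proof.
apply: (iffP forallP) => [h a b|h a]; last by apply/forallP => b; apply/eqP.
by have /forallP/(_ b)/eqP := h a.
Qed.

Definition span (I : finType) (s : I -> V) : {set V} := [set s a | a : I].

Lemma mem_span (I : finType) (s : I -> V) a : s a \in span s.
Proof. exact: imset_f. Qed.

Lemma span_monochromatic (I : finType) (s : I -> V) : depends_on (span s) (monochromatic s).
Proof.
move=> X Y XY; apply/monochromaticP/monochromaticP => h a b;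
by have := h a b; rewrite !XY// mem_span.
Qed.

Lemma monochromatic_matches (I : finType) (s : I -> V) a :
  monochromatic s =1 matches (span s :\ s a) (s a).
Proof.
move=> X; apply/monochromaticP/forall_inP => [h x|h b d].
  by rewrite !inE => /andP[_ /imsetP[b _ ->]]; apply/eqP.
have e i : X (s i) = X (s a).
  have [->//|ne] := eqVneq (s i) (s a).
  by apply/eqP/h; rewrite !inE ne mem_span.
by rewrite !e.
Qed.

Lemma monochromaticI (I J : finType) (s : I -> V) (t : J -> V) a b X :
  s a = t b ->
  monochromatic s X && monochromatic t X =
  monochromatic s X && matches (span t :\: span s) (t b) X.
Proof.
move=> ab; case sX : (monochromatic s X) => //=.
rewrite (monochromatic_matches t b); apply/forall_inP/forall_inP => h x.
  rewrite !inE => /andP[xs xt]; apply: h; rewrite !inE xt andbT.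
  by apply: contraNneq xs => ->; rewrite -ab mem_span.
rewrite !inE => /andP[xb xt].
have [/imsetP[i _ ->]|xs] := boolP (x \in span s); last by apply: h; rewrite !inE xs.
by rewrite -ab; apply/eqP; move/monochromaticP : sX.
Qed.

Lemma mean_monochromaticZ (I : finType) (s : I -> V) a U (Z : Om -> R) :
  injective s -> depends_on U Z -> [disjoint (span s :\ s a) & U] ->
  mean (fun X => Z X * (monochromatic s X)%:R) =
  mean Z * #|C|%:R^-1 ^+ #|I|.-1.
Proof.
move=> s_inj UZ sU.
under eq_mean do rewrite (monochromatic_matches s a).
rewrite (mean_matches UZ)//; last by rewrite !inE eqxx.
congr (_ * _ ^+ _).
by have := cardsD1 (s a) (span s); rewrite mem_span card_imset// => ->.
Qed.

Hypothesis C_gt0 : (0 < #|C|)%N.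

Lemma mean_monochromatic (I : finType) (s : I -> V) : (0 < #|I|)%N ->
  injective s ->
  mean (fun X => (monochromatic s X)%:R : R) = #|C|%:R^-1 ^+ #|I|.-1.
Proof.
move=> /card_gt0P[a _] s_inj; case/card_gt0P : C_gt0 => k _.
have := @mean_monochromaticZ _ s a finset.set0 (fun=> 1) s_inj.
rewrite (mean_cst [ffun=> k]) mul1r => <-//.
  by apply: eq_mean => X; rewrite mul1r.
by rewrite disjoint_sym; apply/pred0P => x; rewrite /= inE.
Qed.

(** If the first map is monochromatic, only the vertices that the second one
    adds still have to match. *)
Lemma mean_monochromaticI (I J : finType) (s : I -> V) (t : J -> V) a b :
  injective s -> s a = t b ->
  mean (fun X => (monochromatic s X)%:R * (monochromatic t X)%:R : R) =
  #|C|%:R^-1 ^+ #|I|.-1 * #|C|%:R^-1 ^+ #|span t :\: span s|.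
Proof.
move=> s_inj ab.
rewrite -(mean_monochromatic _ s_inj); last by apply/card_gt0P; exists a.
rewrite -(@mean_matches (span s) (span t :\: span s) _ (t b)).
- by apply: eq_mean => X; rewrite -!natrM !mulnb (monochromaticI _ ab).
- by move=> X Y XY; rewrite (span_monochromatic XY).
- rewrite -setI_eq0; apply/eqP/setP => x; rewrite !inE.
  by case: (x \in span s); rewrite ?andbF.
- by rewrite !inE -ab mem_span.
Qed.

End colors.

(** * Copies as embeddings up to automorphism *)

Section embeddings.
Variables (H G : sgraph).
Implicit Types (s t : {ffun H -> G}) (g : {perm H}).

Definition embeddings : {set {ffun H -> G}} :=
  [set s : {ffun H -> G} | injectiveb s &
     [forall a, forall b, adj a b ==> adj (s a) (s b)]].

Lemma embeddingsP s :
  reflect (injective s /\ forall a b, adj a b -> adj (s a) (s b))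
          (s \in embeddings).
Proof.
rewrite inE; apply: (iffP andP) => [[/injectiveP si /forallP h]|[si h]].
  by split=> // a b; have /forallP/(_ b)/implyP := h a.
split; first exact/injectiveP.
by apply/forallP => a; apply/forallP => b; apply/implyP/h.
Qed.

Definition precomp s g : {ffun H -> G} := [ffun a => s (g a)].

Lemma automorphismsP g :
  reflect (forall a b, adj (g a) (g b) = adj a b) (g \in automorphisms H).
Proof.
rewrite inE; apply: (iffP forallP) => [h a b|h a]; last first.
  by apply/forallP => b; apply/eqP.
by have /forallP/(_ b)/eqP := h a.
Qed.

Lemma automorphisms1 : (1%g : {perm H}) \in automorphisms H.
Proof. by apply/automorphismsP => a b; rewrite !perm1. Qed.

Lemma automorphismsV g : g \in automorphisms H -> (g^-1)%g \in automorphisms H.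
Proof.
by move=> /automorphismsP h; apply/automorphismsP => a b; rewrite -h !permKV.
Qed.

Lemma automorphismsM g h : g \in automorphisms H -> h \in automorphisms H ->
  (g * h)%g \in automorphisms H.
Proof.
move=> /automorphismsP gP /automorphismsP hP; apply/automorphismsP => a b.
by rewrite !permM hP gP.
Qed.

Lemma card_automorphisms_gt0 : (0 < #|automorphisms H|)%N.
Proof. by apply/card_gt0P; exists 1%g; exact: automorphisms1. Qed.

Lemma precompM s g h : precomp (precomp s g) h = precomp s (h * g)%g.
Proof. by apply/ffunP => a; rewrite !ffunE permM. Qed.

Lemma precomp1 s : precomp s 1%g = s.
Proof. by apply/ffunP => a; rewrite !ffunE perm1. Qed.

Lemma precomp_embeddings s g : s \in embeddings -> g \in automorphisms H ->
  precomp s g \in embeddings.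
Proof.
move=> /embeddingsP[si se] /automorphismsP ga; apply/embeddingsP; split.
  by move=> a b; rewrite !ffunE => /si/perm_inj.
by move=> a b ab; rewrite !ffunE; apply: se; rewrite ga.
Qed.

Lemma monochromatic_precomp (C : finType) s g :
  monochromatic (precomp s g) =1 @monochromatic G C H s.
Proof.
move=> X; apply/monochromaticP/monochromaticP => h a b.
  by have := h (g^-1 a)%g (g^-1 b)%g; rewrite !ffunE !permKV.
by rewrite !ffunE; exact: h.
Qed.

Lemma span_precomp s g : span (precomp s g) = span s.
Proof.
apply/setP => x; apply/imsetP/imsetP => -[a _ ->].
  by exists (g a); rewrite ?ffunE.
by exists (g^-1 a)%g; rewrite // ffunE permKV.
Qed.

(** Two embeddings have the same subgraph of [G] as image exactly when they differ
    by an automorphism of [H]. *)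
Definition same_copy s t := [exists g in automorphisms H, t == precomp s g].

Lemma same_copyP s t :
  reflect (exists2 g, g \in automorphisms H & t = precomp s g) (same_copy s t).
Proof.
by apply: (iffP exists_inP) => -[g gA /eqP gt]; exists g => //; apply/eqP.
Qed.

Lemma same_copy_refl s : same_copy s s.
Proof.
by apply/same_copyP; exists 1%g; rewrite ?precomp1//; exact: automorphisms1.
Qed.

Lemma same_copy_sym s t : same_copy s t = same_copy t s.
Proof.
suff h u v : same_copy u v -> same_copy v u by apply/idP/idP; exact: h.
move=> /same_copyP[g gA ->]; apply/same_copyP; exists g^-1%g.
  exact: automorphismsV.
by rewrite precompM mulVg precomp1.
Qed.

Lemma same_copy_trans s t u : same_copy s t -> same_copy t u -> same_copy s u.
Proof.
move=> /same_copyP[g gA ->] /same_copyP[h hA ->]; apply/same_copyP.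
by exists (h * g)%g; rewrite ?precompM//; exact: automorphismsM.
Qed.

Definition representative s := odflt s [pick t | same_copy s t].

Lemma representative_same s : same_copy s (representative s).
Proof. by rewrite /representative; case: pickP => //= _; exact: same_copy_refl. Qed.

Lemma representative_eq s t : same_copy s t -> representative s = representative t.
Proof.
move=> st; rewrite /representative.
have e : same_copy s =1 same_copy t.
  move=> u; apply/idP/idP; apply: same_copy_trans; rewrite // same_copy_sym//.
rewrite (eq_pick e); case: pickP => //= /(_ t).
by rewrite same_copy_refl.
Qed.

(** One embedding is chosen for each subgraph isomorphic to [H], so that counting
    monochromatic copies yields a natural number. *)
Definition copies : {set {ffun H -> G}} :=
  [set s in embeddings | representative s == s].

Lemma representative_copies s : s \in embeddings -> representative s \in copies.
Proof.
move=> sE; rewrite inE.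
rewrite -(representative_eq (representative_same s)) eqxx andbT.
have /same_copyP[g gA ->] := representative_same s.
exact: precomp_embeddings.
Qed.

Lemma copies_embeddings s : s \in copies -> s \in embeddings.
Proof. by rewrite inE => /andP[]. Qed.

Lemma copies_injective s : s \in copies -> injective s.
Proof. by move=> /copies_embeddings/embeddingsP[]. Qed.

Lemma copies_eq s t : s \in copies -> t \in copies -> same_copy s t -> s = t.
Proof.
rewrite !inE => /andP[_ /eqP rs] /andP[_ /eqP rt] /representative_eq.
by rewrite rs rt.
Qed.

Lemma card_same_copy s : injective s ->
  #|[set t | same_copy s t]| = #|automorphisms H|.
Proof.
move=> si; rewrite -(card_in_imset (f := precomp s)).
  apply: eq_card => t; rewrite inE; apply/same_copyP/imsetP => -[g gA ->];
  by exists g.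
move=> g h _ _ gh; apply/permP => a; apply: si.
by move/ffunP : gh => /(_ a); rewrite !ffunE.
Qed.

Lemma sum_embeddings (R : nzSemiRingType) (f : {ffun H -> G} -> R) :
  (forall s g, g \in automorphisms H -> f (precomp s g) = f s) ->
  \sum_(s in embeddings) f s = #|automorphisms H|%:R * \sum_(s in copies) f s.
Proof.
move=> finv.
rewrite (partition_big representative (mem copies)); last exact: representative_copies.
rewrite mulr_sumr/=.
apply: eq_bigr => t tc; have tE := copies_embeddings tc.
have ti := (embeddingsP _ tE).1.
rewrite (eq_bigr (fun=> f t)); last first.
  move=> s /andP[_ /eqP <-]; have /same_copyP[g gA ->] := representative_same s.
  by rewrite finv.
rewrite sumr_const -(card_same_copy ti) mulr_natl; congr (_ *+ _).
apply: eq_card => s; rewrite !inE/= unfold_in/=.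
apply/andP/idP => [[_ /eqP <-]|ts]; first by rewrite same_copy_sym representative_same.
move: (tc); rewrite inE => /andP[_ /eqP tt].
split; last by rewrite -(representative_eq ts) tt.
by have /same_copyP[g gA ->] := ts; exact: precomp_embeddings.
Qed.

Definition copy_count (C : finType) (X : {ffun G -> C}) : nat :=
  \sum_(s in copies) monochromatic s X.

Lemma copy_count_gt0 (C : finType) (X : {ffun G -> C}) s :
  s \in embeddings -> monochromatic s X -> (0 < copy_count X)%N.
Proof.
move=> sE sX; rewrite /copy_count (bigD1 _ (representative_copies sE))/=.
have /same_copyP[g _ ->] := representative_same s.
by rewrite monochromatic_precomp sX.
Qed.

End embeddings.

Section mono_copies.
Variables (R : realType) (H G : sgraph).

Lemma mono_copiesE (c : nat) (X : coloring G c) :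
  mono_copies R H X = (copy_count H (X : {ffun G -> 'I_c.-1.+1}))%:R.
Proof.
rewrite /mono_copies /copy_count natr_sum.
have a0 : #|automorphisms H|%:R != 0 :> R.
  by rewrite pnatr_eq0 -lt0n card_automorphisms_gt0.
apply: (mulfI a0); rewrite mulrA mulfV// mul1r -sum_embeddings; last first.
  by move=> s g gA; rewrite monochromatic_precomp.
rewrite [RHS]big_mkcond/= big_mkcond/=; apply: eq_bigr => s _.
rewrite inE; case: (injectiveb s) => //=.
case: ifPn => [/forallP h|].
  rewrite big1 ?mul1r// => -[a b] /= /andP[ab _].
  by have /forallP/(_ b)/implyP/(_ ab) -> := h a.
rewrite negb_forall => /existsP[a]; rewrite negb_forall => /existsP[b].
rewrite negb_imply => /andP[ab sab].
have [ltab|ltba|eqab] := ltngtP (enum_rank a) (enum_rank b).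
- by rewrite (bigD1 (a, b)) ?ab//= (negbTE sab) !mul0r.
- by rewrite (bigD1 (b, a)) ?(adj_sym b) ?ab//= adj_sym (negbTE sab) !mul0r.
- by move: ab; rewrite (enum_rank_inj (ord_inj eqab)) adj_irrefl.
Qed.

Lemma mean_copy_count (C : finType) : (0 < #|C|)%N -> (0 < #|H|)%N ->
  mean (fun X : {ffun G -> C} => (copy_count H X)%:R : R) =
  #|copies H G|%:R * #|C|%:R^-1 ^+ #|H|.-1.
Proof.
move=> C0 H0.
under eq_mean do rewrite /copy_count natr_sum.
rewrite mean_sum (eq_bigr (fun=> #|C|%:R^-1 ^+ #|H|.-1)) ?sumr_const ?mulr_natl//.
by move=> s /copies_injective si; rewrite mean_monochromatic.
Qed.

End mono_copies.

(** * From measure theory to finite averages *)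

Section finite_measure.
Variables (R : realType) (G : sgraph) (c : nat).
Local Notation P := (uniform_coloring R G c).
Local Notation Om := {ffun G -> 'I_c.-1.+1}.

Lemma uniform_coloring_mean (p : pred Om) :
  P [set X | p X]%classic = (mean (fun X : Om => (p X)%:R))%:E.
Proof.
rewrite (uniform_coloringE R (p : pred (coloring G c))) /mean.
by rewrite -natr_sum -sum1_card [in RHS]big_mkcond/= [X in X%:R / _]big_mkcond.
Qed.

Lemma ge0_integral_coloring (f : Om -> R) : (forall X, 0 <= f X) ->
  (\int[P]_X (f X)%:E = (mean f)%:E)%E.
Proof.
move=> f0.
transitivity (\int[P]_X \sum_(Y : Om) ((f Y)%:E * (\1_[set Y]%classic X)%:E))%E.
  apply: eq_integral => X _; rewrite (bigD1 (X : Om))//= big1 ?adde0.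
    by rewrite indicE mem_set// mule1.
  move=> Y YX; rewrite indicE memNset ?mule0//=.
  by move=> XY; rewrite XY eqxx in YX.
rewrite ge0_integral_sum//=; last by move=> Y X _; rewrite -EFinM lee_fin mulr_ge0.
rewrite /mean mulr_suml -sumEFin; apply: eq_bigr => Y _.
rewrite ge0_integralZl//; last first.
  by rewrite lee_fin.
rewrite integral_indic// setIT.
transitivity ((f Y)%:E * (mean (fun X : Om => (pred1 Y X)%:R))%:E)%E.
  congr (_ * _)%E; rewrite -uniform_coloring_mean; congr (P _).
  by apply/seteqP; split=> X /= /eqP.
rewrite -EFinM; congr (_ * _)%:E.
rewrite /mean -natr_sum (bigD1 Y)//= eqxx big1 ?addn0 ?mul1r//.
by move=> X /negbTE ->.
Qed.

End finite_measure.

Section mono_copies_moments.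
Variables (R : realType) (H G : sgraph) (c : nat).
Local Notation P := (uniform_coloring R G c).
Local Notation Om := {ffun G -> 'I_c.-1.+1}.
Local Notation T := (fun X : Om => (copy_count H X)%:R : R).
Local Notation X := (mono_copies_rv R H G c).

Lemma mono_copies_fun : (X : coloring G c -> R) = T.
Proof. by apply/funext => w; exact: mono_copiesE. Qed.

Lemma expectation_mono_copies : ('E_P[X] = (mean T)%:E)%E.
Proof.
rewrite expectation_def -ge0_integral_coloring//.
by under eq_integral do rewrite mono_copies_fun.
Qed.

Lemma variance_mono_copies :
  ('V_P[X] = (mean (fun w => (T w - mean T) ^+ 2))%:E)%E.
Proof.
rewrite /variance covariance.unlock expectation_mono_copies/= expectation.unlock.
rewrite -ge0_integral_coloring; last by move=> w; exact: sqr_ge0.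
by apply: eq_integral => w _; rewrite mono_copies_fun.
Qed.

Definition nat_upto (x : R) : nat := if x < 0 then 0%N else (Num.truncn x).+1.

Lemma nat_uptoP (x : R) k : (k%:R <= x) = (k < nat_upto x)%N.
Proof.
rewrite /nat_upto; case: ltrP => x0.
  by rewrite ltn0; apply/negbTE; rewrite -ltNge (lt_le_trans x0).
by rewrite ltnS Num.Theory.truncn_ge_nat.
Qed.

Lemma cdf_mono_copies x :
  cdf X x = (\sum_(k < nat_upto x) mean (fun w : Om => (copy_count H w == k)%:R))%:E.
Proof.
rewrite /cdf /distribution /pushforward.
rewrite [X in P X](_ : _ = [set w | (fun w : Om => copy_count H w < nat_upto x)%N w]%classic).
  apply: etrans (uniform_coloring_mean _ _) _.
  rewrite -mean_sum; congr EFin; apply: eq_mean => w.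
  rewrite -natr_sum; case: ltnP => wx.
    rewrite (bigD1 (Ordinal wx))//= eqxx big1 ?addn0// => i /eqP ix.
    by case: eqP => // e; case: ix; apply/val_inj.
  rewrite big1// => i _; case: eqP => // e.
  by have := ltn_ord i; rewrite -e ltnNge wx.
apply/seteqP; split => w /=; rewrite mono_copies_fun in_itv/= -nat_uptoP//.
Qed.

End mono_copies_moments.

Section poisson_cdf.
Variables (R : realType) (lambda : R).
Hypothesis lambda_gt0 : 0 < lambda.

Lemma cdf_poisson x :
  cdf (poisson_rv lambda) x = (\sum_(k < nat_upto x) poisson_pmf lambda k)%:E.
Proof.
rewrite /cdf /distribution /pushforward.
rewrite [X in _ X = _](_ : _ = `I_(nat_upto x))%classic; last first.
  by apply/seteqP; split => k /=; rewrite in_itv/= -nat_uptoP.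
change (poisson_prob lambda 0 `I_(nat_upto x) =
  (\sum_(k < nat_upto x) poisson_pmf lambda k)%:E).
rewrite /poisson_prob lambda_gt0 esum_fset//; last first.
  by move=> k _; rewrite lee_fin poisson_pmf_ge0.
by rewrite -fsbig_ord sumEFin.
Qed.

End poisson_cdf.

(** * Convergence to the Poisson law *)

Section limits.
Local Open Scope classical_set_scope.
Local Open Scope ring_scope.
Variables (R : realType) (lambda : R).
Hypothesis lambda_gt0 : 0 < lambda.

Lemma cvg0_le (f g : nat -> R) : (\forall n \near \oo, `|f n| <= g n) ->
  g n @[n --> \oo] --> 0 -> f n @[n --> \oo] --> 0.
Proof.
move=> fg g0; apply: (@squeeze_cvgr _ _ _ _ (fun n => - g n) g) => //.
  by near=> n; rewrite -ler_norml; near: n.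
by rewrite -oppr0; exact: cvgN.
Unshelve. all: by end_near. Qed.

Lemma cvg0_eps (f : nat -> R) (C : R) : 0 < C ->
  (forall e, 0 < e -> \forall n \near \oo, `|f n| <= C * e) ->
  f n @[n --> \oo] --> 0.
Proof.
move=> C0 h; apply/cvgr0Pnorm_lt => e e0.
have e1 : 0 < e / (2 * C) by rewrite divr_gt0// mulr_gt0.
near=> n; apply: (@le_lt_trans _ _ (C * (e / (2 * C)))); first by near: n; exact: h.
have -> : C * (e / (2 * C)) = e / 2 by field; rewrite gt_eqF.
by lra.
Unshelve. all: by end_near. Qed.

Definition exp_partial (M : nat) : R := \sum_(k < M) lambda ^+ k / k`!%:R.

Lemma cvg_exp_partial : exp_partial n @[n --> \oo] --> expR lambda.
Proof.
have := is_cvg_series_exp_coeff lambda; rewrite /expR /series/=.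
by under eq_fun do rewrite big_mkord.
Qed.

Lemma poisson_pmfE k :
  poisson_pmf lambda k = expR (- lambda) * (lambda ^+ k / k`!%:R).
Proof. by rewrite /poisson_pmf lambda_gt0 mulrC. Qed.

Lemma cvg_sum_poisson : \sum_(k < n) poisson_pmf lambda k @[n --> \oo] --> (1 : R).
Proof.
rewrite [X in _ --> X](_ : _ = expR (- lambda) * expR lambda); last first.
  by rewrite expRN mulVf// gt_eqF// expR_gt0.
rewrite [X in X @ _ --> _](_ : _ = (fun n => expR (- lambda) * exp_partial n)).
  by apply: cvgM; [exact: cvg_cst|exact: cvg_exp_partial].
apply/funext => n; rewrite /exp_partial mulr_sumr.
by apply: eq_bigr => k _; rewrite poisson_pmfE.
Qed.

(** The recursion determines every probability in terms of the one at [0];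
    the latter is pinned down because no mass escapes to infinity. *)
Lemma poisson_recursion (mu : nat -> R) (p : nat -> nat -> R) :
  (forall n k, 0 <= p n k) ->
  (forall n M, (0 < M)%N -> 1 - mu n / M%:R <= \sum_(k < M) p n k <= 1) ->
  mu n @[n --> \oo] --> lambda ->
  (forall k, k.+1%:R * p n k.+1 - mu n * p n k @[n --> \oo] --> 0) ->
  forall k, p n k @[n --> \oo] --> poisson_pmf lambda k.
Proof.
move=> p0 psum mucvg rec.
have p1 n k : p n k <= 1.
  have /andP[_] := psum n k.+1 isT; rewrite big_ord_recr/=; apply: le_trans.
  by rewrite lerDr sumr_ge0.
have ratio k : p n k - p n 0 * (lambda ^+ k / k`!%:R) @[n --> \oo] --> 0.
  elim: k => [|k IH].
    under eq_fun do rewrite expr0 fact0 divr1 mulr1 subrr.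
    exact: cvg_cst.
  have k1 : k.+1%:R != 0 :> R by rewrite pnatr_eq0.
  have kf : k`!%:R != 0 :> R by rewrite pnatr_eq0 -lt0n fact_gt0.
  have -> : (fun n => p n k.+1 - p n 0 * (lambda ^+ k.+1 / (k.+1)`!%:R)) =
      (fun n => k.+1%:R^-1 * ((k.+1%:R * p n k.+1 - mu n * p n k) +
        ((mu n - lambda) * p n k +
         lambda * (p n k - p n 0 * (lambda ^+ k / k`!%:R))))).
    apply/funext => n; rewrite factS natrM exprS; field.
    by rewrite kf nat1r k1.
  rewrite -[X in _ --> X](mulr0 k.+1%:R^-1); apply: cvgM; first exact: cvg_cst.
  rewrite -[X in _ --> X](addr0 0); apply: cvgD; first exact: rec.
  rewrite -[X in _ --> X](addr0 0); apply: cvgD.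
    apply: (@cvg0_le _ (fun n => `|mu n - lambda|)).
      near=> n; rewrite normrM ler_piMr// ger0_norm//.
    rewrite -(normr0 R); apply: cvg_norm; rewrite -(subrr lambda).
    by apply: cvgB => //; exact: cvg_cst.
  by rewrite -[X in _ --> X](mulr0 lambda); apply: cvgM; [exact: cvg_cst|exact: IH].
have ratios M : \sum_(k < M) p n k - p n 0 * exp_partial M @[n --> \oo] --> 0.
  elim: M => [|M IH].
    rewrite /exp_partial; under eq_fun do rewrite !big_ord0 mulr0 subrr.
    exact: cvg_cst.
  have -> : (fun n => \sum_(k < M.+1) p n k - p n 0 * exp_partial M.+1) =
      (fun n => (\sum_(k < M) p n k - p n 0 * exp_partial M) +
                (p n M - p n 0 * (lambda ^+ M / M`!%:R))).
    by apply/funext => n; rewrite /exp_partial !big_ord_recr/=; ring.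
  by rewrite -[X in _ --> X](addr0 0); apply: cvgD.
have zero : p n 0 * expR lambda - 1 @[n --> \oo] --> 0.
  apply: (@cvg0_eps _ (3 + lambda)); first by rewrite addr_gt0.
  move=> e e0.
  have [M [M0 Me eM]] : exists M, [/\ (0 < M)%N, M%:R^-1 <= e &
      `|expR lambda - exp_partial M| <= e].
    have [N _ hN] : \forall M \near \oo, (0 < M)%N /\ (M%:R^-1 <= e /\
        `|expR lambda - exp_partial M| <= e).
      near=> M; split; first by near: M; exact: nbhs_infty_gt.
      split; last first.
        near: M; exact: (cvgr_dist_le _ _ cvg_exp_partial).
      rewrite invf_ple ?posrE// ?ltr0n; last by near: M; exact: nbhs_infty_gt.
      by near: M; exact: nbhs_infty_ger.
    by have [] := hN N (leqnn N) => ? [? ?]; exists N.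
  near=> n.
  have -> : p n 0 * expR lambda - 1 =
      p n 0 * (expR lambda - exp_partial M) +
      (- (\sum_(k < M) p n k - p n 0 * exp_partial M) +
       (\sum_(k < M) p n k - 1)) by ring.
  have h1 : `|p n 0 * (expR lambda - exp_partial M)| <= e.
    by rewrite normrM ger0_norm// (le_trans _ eM)// ler_piMl.
  have h2 : `|- (\sum_(k < M) p n k - p n 0 * exp_partial M)| <= e.
    by rewrite normrN; near: n; exact: (cvgr0_norm_le _ (ratios M)).
  have h3 : `|\sum_(k < M) p n k - 1| <= (lambda + 1) * e.
    have muM : mu n / M%:R <= (lambda + 1) * e.
      have mul : mu n <= lambda + 1 by near: n; apply: (cvgr_le _ mucvg); rewrite ltrDl.
      apply: (@le_trans _ _ ((lambda + 1) / M%:R)).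
        by rewrite ler_wpM2r// invr_ge0.
      by rewrite ler_wpM2l// addr_ge0// ltW.
    have /andP[? ?] := psum n M M0.
    by rewrite ler_norml; apply/andP; split; lra.
  rewrite (le_trans (ler_normD _ _))// (_ : _ * e = e + (e + (lambda + 1) * e)); last by ring.
  by rewrite lerD// (le_trans (ler_normD _ _))// lerD.
move=> k.
have -> : (fun n => p n k) = (fun n => (p n k - p n 0 * (lambda ^+ k / k`!%:R)) +
    ((p n 0 * expR lambda - 1) * poisson_pmf lambda k + poisson_pmf lambda k)).
  apply/funext => n; rewrite poisson_pmfE expRN; field.
  by rewrite pnatr_eq0 -lt0n fact_gt0/= gt_eqF ?expR_gt0.
rewrite -[X in _ --> X]add0r; apply: cvgD; first exact: ratio.
rewrite -[X in _ --> X]add0r; apply: cvgD; last exact: cvg_cst.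
by rewrite -[X in _ --> X](mul0r (poisson_pmf lambda k)); apply: cvgM => //; exact: cvg_cst.
Unshelve. all: by end_near. Qed.

End limits.

Section counts.
Local Open Scope classical_set_scope.
Local Open Scope ring_scope.
Variables (R : realType) (lambda : R).
Hypothesis lambda_gt0 : 0 < lambda.

Lemma sum_pmf (W : finType) (T : W -> nat) M :
  \sum_(k < M) mean (fun w => (T w == k)%:R : R) = mean (fun w => (T w < M)%:R).
Proof.
rewrite -mean_sum; apply: eq_mean => w; rewrite -natr_sum.
case: ltnP => wM.
  rewrite (bigD1 (Ordinal wM))//= eqxx big1 ?addn0// => i /eqP ix.
  by case: eqP => // e; case: ix; apply/val_inj.
rewrite big1// => i _; case: eqP => // e.
by have := ltn_ord i; rewrite -e ltnNge wM.
Qed.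

(** Chen's bound, applied to the indicators of single values, is the recursion
    that characterizes the Poisson law. *)
Lemma poisson_of_chen (W : nat -> finType) (T : forall n, W n -> nat) :
  (forall n, (0 < #|W n|)%N) ->
  mean (fun w => (T n w)%:R : R) @[n --> \oo] --> lambda ->
  (forall e, 0 < e -> \forall n \near \oo,
    forall h : nat -> R, (forall k, 0 <= h k <= 1) ->
    `|mean (fun w => (T n w)%:R * h (T n w)) -
      mean (fun w => (T n w)%:R) * mean (fun w => h (T n w).+1)| <= e) ->
  forall k, mean (fun w => (T n w == k)%:R : R) @[n --> \oo] -->
            poisson_pmf lambda k.
Proof.
move=> W0 mucvg chen.
apply: (poisson_recursion lambda_gt0 (mu := fun n => mean (fun w => (T n w)%:R))) => //.
- by move=> n k; apply: mean_ge0.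
- move=> n M M0; rewrite sum_pmf; have /card_gt0P[w0 _] := W0 n.
  have one := mean_cst w0 (1 : R); apply/andP; split; last first.
    by rewrite -[leRHS]one; apply: le_mean => w; case: (_ < _)%N.
  rewrite -{1}one mulrC -meanZ -meanB; apply: le_mean => w.
  case: ltnP => [_|MT]; first by rewrite gerBl mulr_ge0// invr_ge0.
  by rewrite subr_le0 ler_pdivlMl ?ltr0n// mulr1 ler_nat.
- move=> k; apply: (cvg0_eps (C := 1)) => // e e0; rewrite mul1r.
  near=> n.
  have := near (chen e e0) n _ (fun l => (l == k.+1)%:R).
  have -> : mean (fun w => (T n w)%:R * (T n w == k.+1)%:R) =
      k.+1%:R * mean (fun w => (T n w == k.+1)%:R : R).
    rewrite -meanZ; apply: eq_mean => w.
    by case: eqP => [->//|_]; rewrite !mulr0.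
  have -> : mean (fun w => ((T n w).+1 == k.+1)%:R) =
      mean (fun w => (T n w == k)%:R : R) by apply: eq_mean => w; rewrite eqSS.
  by apply=> // l; rewrite ler0n lern1 leq_b1.
Unshelve. all: by end_near. Qed.

Variables (H : sgraph) (G : nat -> sgraph) (c : nat -> nat).

Definition coloring_seq n : finType := {ffun G n -> 'I_(c n).-1.+1}.

Definition pmf n k : R := mean (fun w : coloring_seq n => (copy_count H w == k)%:R).

Definition count_mean n : R :=
  mean (fun w : coloring_seq n => (copy_count H w)%:R).

Definition count_variance n : R :=
  mean (fun w : coloring_seq n => ((copy_count H w)%:R - count_mean n) ^+ 2).

(** Both laws live on the naturals, so convergence in distribution can be tested
    halfway between consecutive naturals, where the limiting distribution
    function is locally constant. *)
Lemma cvg_in_distributionP :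
  cvg_in_distribution (fun n => mono_copies_rv R H (G n) (c n))
    (poisson_rv lambda) <->
  forall k, pmf n k @[n --> \oo] --> poisson_pmf lambda k.
Proof.
have partial M : (forall k, pmf n k @[n --> \oo] --> poisson_pmf lambda k) ->
    \sum_(k < M) pmf n k @[n --> \oo] --> \sum_(k < M) poisson_pmf lambda k.
  move=> h; elim: M => [|M IH].
    by under eq_fun do rewrite big_ord0; rewrite big_ord0; exact: cvg_cst.
  by under eq_fun do rewrite big_ord_recr/=; rewrite big_ord_recr/=; exact: cvgD.
split=> [h|h x _]; last first.
  under eq_fun do rewrite cdf_mono_copies.
  rewrite cdf_poisson//; apply: cvg_EFin; last exact: partial.
  by near=> n.
have half M : (M%:R + 2^-1 : R) < M.+1%:R.
  by rewrite -[M.+1%:R]natr1 ltrD2l invf_lt1 ?ltr1n.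
have uptoE M (y : R) : M%:R <= y < M.+1%:R -> nat_upto y = M.+1.
  move=> /andP[My yM]; apply/eqP; rewrite eqn_leq -nat_uptoP My andbT.
  by rewrite leqNgt -nat_uptoP -ltNge yM.
have half0 M : nat_upto (M%:R + 2^-1 : R) = M.+1.
  by apply: uptoE; rewrite half lerDl invr_ge0 ler0n.
have cont M : {for M%:R + 2^-1, continuous (cdf (poisson_rv lambda))}.
  apply: (near_cst_continuous (\sum_(k < M.+1) poisson_pmf lambda k)%:E).
  near=> y.
  rewrite cdf_poisson// (uptoE M)//.
  apply/andP; split; near: y.
    apply: filterS (lt_nbhsr _) => [z|]; first exact: ltW.
    by rewrite ltrDl invr_gt0.
  exact: lt_nbhsl.
have sums M : \sum_(k < M) pmf n k @[n --> \oo] --> \sum_(k < M) poisson_pmf lambda k.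
  case: M => [|M].
    by under eq_fun do rewrite big_ord0; rewrite big_ord0; exact: cvg_cst.
  have := h _ (cont M); rewrite cdf_poisson// half0.
  under eq_fun do rewrite cdf_mono_copies half0.
  by move/fine_cvg.
move=> k.
have -> : pmf ^~ k = (fun n => \sum_(j < k.+1) pmf n j - \sum_(j < k) pmf n j).
  by apply/funext => n; rewrite big_ord_recr/= addrAC subrr add0r.
have -> : poisson_pmf lambda k =
    \sum_(j < k.+1) poisson_pmf lambda j - \sum_(j < k) poisson_pmf lambda j.
  by rewrite big_ord_recr/= addrAC subrr add0r.
exact: cvgB.
Unshelve. all: by end_near. Qed.

End counts.

(** * Counting stars *)

Section star_counting.
Variables (R : realType) (r : nat) (G : sgraph).
Local Notation K := (star r).
Local Notation E := (embeddings K G).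
Let o : K := (ord0 : 'I_r.+1).

Definition neighbors (v : G) : {set G} := [set x | adj v x].

Lemma card_star : #|K| = r.+1.
Proof. exact: card_ord. Qed.

Lemma card_leaves : #|[pred i : K | i != o]| = r.
Proof. by have := cardC1 o; rewrite card_star. Qed.

Lemma star_embeddings (s : {ffun K -> G}) :
  reflect (injective s /\ forall i, i != o -> adj (s o) (s i)) (s \in E).
Proof.
apply: (iffP (embeddingsP _)) => -[si h]; split=> //.
  by move=> i io; apply: h; rewrite /= /star_adj eqxx.
move=> i j; rewrite /= /star_adj -/o.
case: (eqVneq i o) => [->|io]; case: (eqVneq j o) => [->|jo] //= _.
  exact: h.
by rewrite adj_sym; exact: h.
Qed.

Variables (w : G -> R) (B : R).
Hypothesis w_ge0 : forall x, 0 <= w x.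
Hypothesis wB : forall v, \sum_(x in neighbors v) w x <= B.

Lemma sum_star_at_center v :
  \sum_(s in E | s o == v) \prod_i w (s i) <= w v * B ^+ r.
Proof.
pose A i x := if i == o then (x == v)%:R * w v else (adj v x)%:R * w x.
have A0 i x : 0 <= A i x by rewrite /A; case: eqP => _; rewrite mulr_ge0.
apply: (@le_trans _ _ (\sum_(s : {ffun K -> G}) \prod_i A i (s i))).
  rewrite big_mkcond/= ler_sum// => s _; case: ifP => [|_]; last exact: prodr_ge0.
  move=> /andP[/star_embeddings[_ h] /eqP sv].
  apply/eq_ler/eq_bigr => i _; rewrite /A.
  by case: eqP => [->|/eqP/h]; rewrite sv ?eqxx ?mul1r// => ->; rewrite mul1r.
rewrite -bigA_distr_bigA (bigD1 o)//=.
have -> : \sum_x A o x = w v.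
  rewrite /A eqxx (bigD1 v)//= eqxx mul1r big1 ?addr0// => x /negbTE ->.
  by rewrite mul0r.
rewrite ler_wpM2l// -[in B ^+ _]card_leaves -prodr_const ler_prod// => i io.
rewrite sumr_ge0//= (le_trans _ (wB v))// [leRHS]big_mkcond/=.
apply/eq_ler/eq_bigr => x _; rewrite /A (negbTE io) inE.
by case: adj; rewrite ?mul1r ?mul0r.
Qed.

Lemma sum_star_at_leaf i u : i != o ->
  \sum_(s in E | s i == u) \prod_j w (s j) <= w u * B ^+ r.
Proof.
move=> io; pose A v j x := if j == o then (x == v)%:R * w v else
  if j == i then (x == u)%:R * (adj u v)%:R * w u else (adj v x)%:R * w x.
have A0 v j x : 0 <= A v j x.
  by rewrite /A; case: eqP => _; [|case: eqP => _]; rewrite !mulr_ge0.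
apply: (@le_trans _ _ (\sum_v \sum_(s : {ffun K -> G}) \prod_j A v j (s j))).
  rewrite (partition_big (fun s : {ffun K -> G} => s o) predT)//= ler_sum// => v _.
  rewrite big_mkcond/= ler_sum// => s _; case: ifP => [|_]; last exact: prodr_ge0.
  move=> /andP[/andP[/star_embeddings[_ h] /eqP su] /eqP sv].
  apply/eq_ler/eq_bigr => j _; rewrite /A.
  case: (eqVneq j o) => [->|jo]; first by rewrite sv eqxx mul1r.
  case: (eqVneq j i) => [->|ji]; last by rewrite -sv h// mul1r.
  by rewrite su eqxx adj_sym -sv -su h// !mul1r.
have r0 : (0 < r)%N.
  apply: (@leq_trans #|[pred i : K | i != o]|); last by rewrite card_leaves.
  by apply/card_gt0P; exists i.
have Bge0 : 0 <= B by rewrite (le_trans _ (wB u))// sumr_ge0.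
have key v : \sum_(s : {ffun K -> G}) \prod_j A v j (s j) <=
    (adj u v)%:R * w v * (w u * B ^+ r.-1).
  rewrite -bigA_distr_bigA (bigD1 o)//= (bigD1 i)//=.
  have -> : \sum_x A v o x = w v.
    rewrite /A eqxx (bigD1 v)//= eqxx mul1r big1 ?addr0// => x /negbTE ->.
    by rewrite mul0r.
  have -> : \sum_x A v i x = (adj u v)%:R * w u.
    rewrite /A (negbTE io) eqxx (bigD1 u)//= eqxx mul1r big1 ?addr0// => x /negbTE ->.
    by rewrite !mul0r.
  rewrite mulrA [w v * _]mulrCA -!mulrA !ler_wpM2l//.
  have cl : #|[pred j : K | (j != o) && (j != i)]| = r.-1.
    apply: succn_inj; rewrite prednK//; apply: etrans card_leaves.
    rewrite [RHS](cardD1 i) inE/= io add1n; congr _.+1.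
    by apply: eq_card => j; rewrite !inE andbC.
  rewrite -cl -prodr_const ler_prod// => j /andP[jo ji].
  rewrite sumr_ge0//= (le_trans _ (wB v))// [leRHS]big_mkcond/=.
  apply/eq_ler/eq_bigr => x _; rewrite /A (negbTE jo) (negbTE ji) inE.
  by case: adj; rewrite ?mul1r ?mul0r.
rewrite (le_trans (ler_sum _ (fun v _ => key v)))// -mulr_suml.
rewrite -[in leRHS](prednK r0) exprS [leRHS]mulrCA ler_wpM2r//.
  by rewrite mulr_ge0// exprn_ge0.
rewrite (le_trans _ (wB u))// [leRHS]big_mkcond/=.
apply/eq_ler/eq_bigr => x _; rewrite inE.
by case: adj; rewrite ?mul1r ?mul0r.
Qed.

(** With unit weights this counts stars through a vertex.  A star is explored from
    the given vertex along its edges, so the weight of each further vertex is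
    summed over the neighborhood of one already explored. *)
Lemma sum_star_at i u :
  \sum_(s in E | s i == u) \prod_j w (s j) <= w u * B ^+ r.
Proof.
by have [->|io] := eqVneq i o; [exact: sum_star_at_center|exact: sum_star_at_leaf].
Qed.

Lemma sum_star_meeting (U : {set G}) :
  \sum_(s in E | ~~ [disjoint span s & U]) \prod_j w (s j) <=
  r.+1%:R * (\sum_(u in U) w u) * B ^+ r.
Proof.
have f0 (s : {ffun K -> G}) : 0 <= \prod_j w (s j) by apply: prodr_ge0.
apply: (@le_trans _ _ (\sum_(s in E) \sum_(i : K) \sum_(u in U)
    (s i == u)%:R * \prod_j w (s j))).
  rewrite big_mkcondr/= ler_sum// => s sE; case: ifPn => [|_]; last first.
    by apply: sumr_ge0 => i _; apply: sumr_ge0 => u _; exact: mulr_ge0.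
  rewrite -setI_eq0 => /set0Pn[x]; rewrite inE => /andP[/imsetP[i _ ->] siU].
  rewrite [leRHS](bigD1 i)//= [X in _ <= X + _](bigD1 (s i))//=.
  rewrite eqxx mul1r -addrA lerDl.
  rewrite addr_ge0//; apply: sumr_ge0 => j _; last first.
    by apply: sumr_ge0 => u _; exact: mulr_ge0.
  exact: mulr_ge0.
rewrite exchange_big/= -[in leRHS]card_star.
apply: (@le_trans _ _ (\sum_(i : K) \sum_(u in U) w u * B ^+ r)).
  apply: ler_sum => i _; rewrite exchange_big/= ler_sum// => u _.
  apply: le_trans (sum_star_at i u).
  rewrite [leRHS]big_mkcondr/= ler_sum// => s _.
  by case: eqP; rewrite ?mul1r ?mul0r.
by rewrite sumr_const -mulr_suml -mulrA mulr_natl.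
Qed.

End star_counting.

(** * Moments of star counts under a linear degree bound *)

Section star_moments.
Variables (R : realType) (r : nat) (G : sgraph) (C : finType) (kappa : R).
Hypothesis C_gt0 : (0 < #|C|)%N.
Hypothesis kappa_ge0 : 0 <= kappa.
Hypothesis degree_le :
  forall v : G, #|neighbors v|%:R <= kappa * #|C|%:R :> R.
Local Notation K := (star r).
Local Notation Om := {ffun G -> C}.
Local Notation T := (fun X : Om => (copy_count K X)%:R : R).

(** Bounds the expected number of monochromatic stars that touch [u] given
    vertices. *)
Definition touching (u : nat) : R := r.+1%:R * u%:R * (u%:R + kappa) ^+ r.

Lemma touching_ge0 u : 0 <= touching u.
Proof. by rewrite !mulr_ge0// exprn_ge0// addr_ge0. Qed.

Lemma touching_le u v : (u <= v)%N -> touching u <= touching v.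
Proof.
move=> uv; rewrite /touching ler_pM// ?mulr_ge0// ?exprn_ge0// ?addr_ge0//.
  by rewrite ler_wpM2l// ler_nat.
by rewrite lerXn2r// ?nnegrE ?addr_ge0// lerD2r ler_nat.
Qed.

Let cR_gt0 : 0 < #|C|%:R :> R. Proof. by rewrite ltr0n. Qed.

(** Conditioning on the colors inside [U] raises the expected number of
    monochromatic stars by a bounded amount: a star that avoids [U] is
    independent of them, and each vertex of a star touching [U] costs a factor
    [#|C|^-1] if outside [U] but is confined to [U] otherwise. *)
Lemma mean_times_copy_count (U : {set G}) (Z : Om -> R) :
  (forall X, 0 <= Z X) -> depends_on U Z ->
  mean (fun X => Z X * T X) <= mean Z * (mean T + touching #|U|).
Proof.
move=> Z0 UZ; have mZ0 : 0 <= mean Z by exact: mean_ge0.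
(* bounds the probability, given the colors in U, of the common color at x *)
pose w x : R := if x \in U then 1 else #|C|%:R^-1.
have w0 x : 0 <= w x by rewrite /w; case: ifP; rewrite ?invr_ge0.
have -> : mean (fun X => Z X * T X) =
    \sum_(s in copies K G) mean (fun X => Z X * (monochromatic s X)%:R).
  by rewrite -mean_sum; apply: eq_mean => X; rewrite /copy_count natr_sum mulr_sumr.
have -> : mean T =
    \sum_(s in copies K G) mean (fun X : Om => (monochromatic s X)%:R).
  by rewrite -mean_sum; apply: eq_mean => X; rewrite /copy_count natr_sum.
rewrite (bigID (fun s : {ffun K -> G} => [disjoint span s & U]))/= mulrDr lerD//.
  rewrite mulr_sumr [leRHS](bigID (fun s : {ffun K -> G} => [disjoint span s & U]))/=.
  rewrite -[leLHS]addr0 lerD//; last first.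
    by apply: sumr_ge0 => s _; rewrite mulr_ge0//; apply: mean_ge0.
  apply: ler_sum => s /andP[sc sU]; have si := @copies_injective K G s sc.
  rewrite (mean_monochromatic R C_gt0 _ si) ?card_star//.
  rewrite (mean_monochromaticZ (a := ord0 : 'I_r.+1) si UZ) ?card_star//.
  by apply: disjointWl sU; exact: subsetDl.
apply: (@le_trans _ _ (mean Z *
    \sum_(s in embeddings K G | ~~ [disjoint span s & U]) \prod_j w (s j))).
  rewrite mulr_sumr.
  apply: (@le_trans _ _ (\sum_(s in copies K G | ~~ [disjoint span s & U])
      mean Z * \prod_j w (s j))); last first.
    rewrite [leLHS]big_mkcond [leRHS]big_mkcond/= ler_sum// => s _.
    case: ifP => [/andP[/(@copies_embeddings K G) -> ->]//|_].
    by case: ifP => // _; rewrite mulr_ge0// prodr_ge0.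
  apply: ler_sum => s /andP[sc]; have si := @copies_injective K G s sc.
  rewrite -setI_eq0 => /set0Pn[x]; rewrite inE => /andP[/imsetP[i _ ->] siU].
  have -> : \prod_j w (s j) = #|C|%:R^-1 ^+ #|span s :\: U|.
    rewrite (bigID (fun j => s j \in U))/= big1 ?mul1r; last first.
      by move=> j jU; rewrite /w jU.
    rewrite (eq_bigr (fun=> #|C|%:R^-1)); last by move=> j /negbTE jU; rewrite /w jU.
    rewrite prodr_const; congr (_ ^+ _).
    rewrite -(card_imset _ si); apply: eq_card => {}x; rewrite !inE.
    apply/imsetP/andP => [[j jU ->]|[xU /imsetP[j _ xj]]].
      by have {}jU : s j \notin U := jU; rewrite jU mem_span.
    by exists j => //; rewrite [_ \in _](_ : _ = (s j \notin U))// -xj.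
  rewrite -(mean_matches (u := s i) UZ); last 2 first.
  - rewrite -setI_eq0; apply/eqP/setP => {}x; rewrite !inE.
    by case: (x \in U); rewrite ?andbF.
  - by rewrite !inE siU.
  apply: le_mean => X; apply: ler_wpM2l => //; rewrite ler_nat.
  case sX : (monochromatic s X) => //; rewrite lt0b.
  apply/forall_inP => {}x; rewrite !inE => /andP[_ /imsetP[j _ ->]].
  by apply/eqP; move/monochromaticP : sX; apply.
apply: ler_wpM2l => //.
have -> : touching #|U| = r.+1%:R * (\sum_(u in U) w u) * (#|U|%:R + kappa) ^+ r.
  rewrite /touching; congr (_ * _ * _).
  by rewrite (eq_bigr (fun=> 1)) ?sumr_const// => u uU; rewrite /w uU.
apply: sum_star_meeting => // v.
rewrite (bigID (fun x => x \in U))/= lerD//.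
  rewrite (eq_bigr (fun=> 1)); last by move=> x /andP[_ xU]; rewrite /w xU.
  rewrite sumr_const ler_nat subset_leq_card//; apply/fintype.subsetP => x.
  by move=> /andP[].
rewrite (eq_bigr (fun=> #|C|%:R^-1)); last first.
  by move=> x /andP[_ /negbTE xU]; rewrite /w xU.
rewrite sumr_const -[_ *+ _]mulr_natl ler_pdivrMr// (le_trans _ (degree_le v))//.
rewrite ler_nat subset_leq_card//; apply/fintype.subsetP => x.
by move=> /andP[].
Qed.

(** The conditional bound applies to the indicator of one monochromatic star, and
    then to that of a pair of them. *)
Lemma second_moment_le :
  mean (fun X => T X ^+ 2) <= mean T * (mean T + touching r.+1).
Proof.
have mT0 : 0 <= mean T by apply: mean_ge0.
apply: (@le_trans _ _ (\sum_(s in copies K G)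
    mean (fun X => (monochromatic s X)%:R * T X))).
  rewrite -mean_sum; apply: le_mean => X.
  by rewrite -mulr_suml expr2 {1}/copy_count natr_sum.
have {1}-> : mean T =
    \sum_(s in copies K G) mean (fun X : Om => (monochromatic s X)%:R).
  by rewrite -mean_sum; apply: eq_mean => X; rewrite /copy_count natr_sum.
rewrite mulr_suml; apply: ler_sum => s /(@copies_injective K G) si.
rewrite -[in touching _](card_star r) -(card_imset _ si).
apply: mean_times_copy_count => // X Y XY.
by rewrite (span_monochromatic XY).
Qed.

Lemma third_moment_le :
  mean (fun X => T X ^+ 3) <=
  mean T * (mean T + touching r.+1) * (mean T + touching (r.+1 + r.+1)).
Proof.
have mT0 : 0 <= mean T by apply: mean_ge0.
apply: (@le_trans _ _ (mean (fun X => T X ^+ 2) *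
    (mean T + touching (r.+1 + r.+1)))); last first.
  by rewrite ler_wpM2r ?second_moment_le// addr_ge0// touching_ge0.
have T2 X : T X ^+ 2 = \sum_(s in copies K G) \sum_(t in copies K G)
    (monochromatic s X)%:R * (monochromatic t X)%:R.
  have TE : T X = \sum_(s in copies K G) (monochromatic s X)%:R.
    by rewrite /copy_count natr_sum.
  rewrite expr2 TE mulr_suml; apply: eq_bigr => s _.
  by rewrite mulr_sumr.
have -> : mean (fun X => T X ^+ 3) = \sum_(s in copies K G) \sum_(t in copies K G)
    mean (fun X => (monochromatic s X)%:R * (monochromatic t X)%:R * T X).
  under [RHS]eq_bigr do rewrite -mean_sum.
  rewrite -mean_sum; apply: eq_mean => X; rewrite exprSr T2 mulr_suml.
  by apply: eq_bigr => s _; rewrite mulr_suml.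
have -> : mean (fun X => T X ^+ 2) = \sum_(s in copies K G) \sum_(t in copies K G)
    mean (fun X : Om => (monochromatic s X)%:R * (monochromatic t X)%:R).
  under [RHS]eq_bigr do rewrite -mean_sum.
  by rewrite -mean_sum; apply: eq_mean => X; rewrite T2.
rewrite mulr_suml; apply: ler_sum => s /(@copies_injective K G) si.
rewrite mulr_suml; apply: ler_sum => t /(@copies_injective K G) ti.
apply: le_trans (mean_times_copy_count (U := span s :|: span t) _ _) _.
- by move=> X; rewrite mulr_ge0.
- move=> X Y XY; congr ((_ : bool)%:R * (_ : bool)%:R);
  by apply: span_monochromatic => x xs; rewrite XY// inE xs ?orbT.
rewrite ler_wpM2l ?lerD2l ?touching_le//.
  by apply: mean_ge0 => X; rewrite mulr_ge0.
rewrite -[X in (_ <= X + X)%N](card_star r) -{1}(card_imset _ si) -(card_imset _ ti).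
by rewrite cardsU leq_subr.
Qed.

End star_moments.

(** * Poisson limits force convergence of the moments *)

Section no_star.
Variables (R : realType) (r : nat) (G : sgraph) (C : finType).
Hypothesis C_gt0 : (0 < #|C|)%N.
Hypothesis r_gt0 : (0 < r)%N.
Local Notation K := (star r).
Local Notation Om := {ffun G -> C}.

Definition mono_degree (v : G) (X : Om) : nat :=
  \sum_(x in neighbors v) (X x == X v).

Lemma mono_degree_lt (v : G) (X : Om) :
  copy_count K X = 0%N -> (mono_degree v X < r)%N.
Proof.
move=> T0; rewrite ltnNge; apply/negP => rD.
suff : (0 < copy_count K X)%N by rewrite T0.
pose A := [set x in neighbors v | X x == X v].
have cA : #|A| = mono_degree v X.
  rewrite /mono_degree -sum1_card big_mkcond [RHS]big_mkcond/=.
  by apply: eq_bigr => x _; rewrite !inE; case: adj; case: eqP.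
pose L := v :: enum A.
have vA : v \notin A by rewrite !inE adj_irrefl.
have L_uniq : uniq L by rewrite /= mem_enum vA enum_uniq.
have szL : (r < size L)%N by rewrite /= -cardE cA ltnS.
pose s : {ffun K -> G} := [ffun i : K => nth v L (i : 'I_r.+1)].
have iL (i : 'I_r.+1) : (i < size L)%N by rewrite (leq_ltn_trans _ szL)// -ltnS.
have sA (i : K) : i != (ord0 : 'I_r.+1) -> s i \in A.
  rewrite ffunE; case: i => -[|i] //= ir _.
  by rewrite -mem_enum mem_nth// -ltnS; exact: (iL (Ordinal ir)).
apply: (@copy_count_gt0 K G C X s).
  apply/star_embeddings; split.
    move=> i j /eqP; rewrite !ffunE nth_uniq ?iL// => /eqP ij.
    exact: ord_inj.
  by move=> i /sA; rewrite !inE => /andP[+ _]; rewrite [s (ord0 : 'I_r.+1)]ffunE.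
have sX (i : K) : X (s i) = X v.
  have [->|/sA] := eqVneq i (ord0 : 'I_r.+1); first by rewrite ffunE.
  by rewrite inE => /andP[_ /eqP].
by apply/monochromaticP => a b; rewrite !sX.
Qed.

Let c : R := #|C|%:R.
Let c_gt0 : 0 < c. Proof. by rewrite ltr0n. Qed.

Lemma mean_match2 (v x y : G) : adj v x -> adj v y ->
  mean (fun X : Om => (X x == X v)%:R * (X y == X v)%:R : R) =
  c^-1 ^+ #|[set x; y]|.
Proof.
move=> vx vy; have /card_gt0P[k _] := C_gt0.
have := @mean_matches R G C finset.set0 [set x; y] (fun=> 1) v.
rewrite (mean_cst [ffun=> k]) mul1r => <- //.
- apply: eq_mean => X; rewrite mul1r -natrM mulnb; congr (_ : bool)%:R.
  apply/andP/forall_inP => [[xv yv] z|h]; first by rewrite !inE => /orP[] /eqP ->.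
  by split; apply: h; rewrite !inE eqxx ?orbT.
- by rewrite disjoint_sym; apply/pred0P => z; rewrite /= inE.
- rewrite !inE; apply/norP; split; apply/eqP => e.
    by rewrite -e adj_irrefl in vx.
  by rewrite -e adj_irrefl in vy.
Qed.

(** The number of neighbors of [v] sharing its color is binomial; Chebyshev's
    inequality bounds the probability that it falls below half its mean. *)
Lemma prob_no_star_degree (v : G) :
  2 * r%:R * c <= #|neighbors v|%:R ->
  mean (fun X : Om => (copy_count K X == 0)%:R : R) * #|neighbors v|%:R <= 4 * c.
Proof.
set d : R := #|neighbors v|%:R => dr.
have r0 : 0 < r%:R :> R by rewrite ltr0n.
have d0 : 0 < d by rewrite (lt_le_trans _ dr)// !mulr_gt0.
pose m := d / c.
have /card_gt0P[k _] := C_gt0.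
have ED : mean (fun X : Om => (mono_degree v X)%:R : R) = m.
  under eq_mean do rewrite /mono_degree natr_sum.
  rewrite mean_sum (eq_bigr (fun=> c^-1)); last first.
    move=> x; rewrite inE => vx.
    have := mean_match2 vx vx; rewrite finset.setUid cards1 expr1 => <-.
    by apply: eq_mean => X; rewrite -natrM mulnb andbb.
  by rewrite sumr_const -[c^-1 *+ _]mulr_natl.
have ED2 : mean (fun X : Om => (mono_degree v X)%:R ^+ 2 : R) <= m ^+ 2 + m.
  have -> : mean (fun X : Om => (mono_degree v X)%:R ^+ 2 : R) =
      \sum_(x in neighbors v) \sum_(y in neighbors v) c^-1 ^+ #|[set x; y]|.
    transitivity (\sum_(x in neighbors v) \sum_(y in neighbors v)
        mean (fun X : Om => (X x == X v)%:R * (X y == X v)%:R : R)).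
      under [RHS]eq_bigr do rewrite -mean_sum.
      rewrite -mean_sum; apply: eq_mean => X.
      rewrite /mono_degree natr_sum expr2 mulr_suml.
      by apply: eq_bigr => x _; rewrite mulr_sumr.
    apply: eq_bigr => x; rewrite inE => vx.
    by apply: eq_bigr => y; rewrite inE => vy; exact: mean_match2.
  have key x : x \in neighbors v ->
      \sum_(y in neighbors v) c^-1 ^+ #|[set x; y]| <= d * c^-1 ^+ 2 + c^-1.
    move=> xv; rewrite (bigD1 x)//= finset.setUid cards1 expr1 addrC lerD2r.
    apply: (@le_trans _ _ (\sum_(y in neighbors v) c^-1 ^+ 2)); last first.
      by rewrite sumr_const -[_ *+ _]mulr_natl.
    rewrite big_mkcondr/= ler_sum// => y _; case: eqVneq => [_|yx]/=.
      by rewrite exprn_ge0// invr_ge0 ltW.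
    by rewrite cards2 eq_sym yx.
  rewrite (le_trans (ler_sum _ key))// sumr_const -[_ *+ _]mulr_natl -/d /m.
  by apply: eq_ler; field; rewrite gt_eqF.
have var : mean (fun X : Om => ((mono_degree v X)%:R - m) ^+ 2 : R) <= m.
  by rewrite -{1}ED (mean_sqr_dev [ffun=> k]) ED lerBlDl.
set q := mean _.
have : q * (m / 2) ^+ 2 <= m.
  apply: le_trans var; rewrite mulrC /q -meanZ; apply: le_mean => X.
  case: eqP => [/mono_degree_lt Dr|_]; last by rewrite mulr0 sqr_ge0.
  rewrite mulr1 -[leRHS]sqrrN lerXn2r ?nnegrE//.
  - by rewrite !divr_ge0// ltW.
  - rewrite opprB subr_ge0; apply: (@le_trans _ _ r%:R); first by rewrite ler_nat ltnW// Dr.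
    by rewrite /m ler_pdivlMr// (le_trans _ dr)// ler_wpM2r// ?ltW//; lra.
  - rewrite opprB lerBrDr.
    suff : (mono_degree v X)%:R <= m / 2 by lra.
    apply: (@le_trans _ _ r%:R); first by rewrite ler_nat ltnW// Dr.
    by rewrite /m -mulrA -invfM ler_pdivlMr ?mulr_gt0//; lra.
have m0 : 0 < m by rewrite divr_gt0.
have -> : q * (m / 2) ^+ 2 = q * m / 4 * m by field.
rewrite -[leRHS]mul1r ler_pM2r// => qm.
have -> : q * d = (q * m / 4) * (4 * c) by rewrite /m; field; rewrite gt_eqF.
by rewrite ler_piMl// mulr_ge0// ltW.
Qed.

Variable delta : R.
Hypothesis delta_gt0 : 0 < delta.
Hypothesis no_star : delta <= mean (fun X : Om => (copy_count K X == 0)%:R).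

Definition degree_slope : R := 2 * r%:R + 4 / delta.

Lemma degree_slope_ge0 : 0 <= degree_slope.
Proof. by rewrite addr_ge0 ?mulr_ge0// invr_ge0 ltW. Qed.

Lemma degree_linear (v : G) : #|neighbors v|%:R <= degree_slope * c.
Proof.
rewrite /degree_slope mulrDl.
have [dr|/ltW dr] := lerP (2 * r%:R * c) #|neighbors v|%:R; last first.
  by rewrite (le_trans dr)// lerDl mulr_ge0 ?divr_ge0// ltW.
apply: (@le_trans _ _ (4 / delta * c)); last by rewrite lerDr !mulr_ge0// ltW.
rewrite mulrAC ler_pdivlMr// mulrC.
by rewrite (le_trans _ (prob_no_star_degree dr))// ler_wpM2r.
Qed.

Let K1 := touching r degree_slope r.+1.
Let K2 := touching r degree_slope (r.+1 + r.+1).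
Let B := K1 / delta.

(** The variance is at most a multiple of the mean, so by Chebyshev's inequality a
    large mean would make the absence of monochromatic stars unlikely. *)
Lemma mean_stars_bounded : mean (fun X : Om => (copy_count K X)%:R) <= B.
Proof.
set m := mean _.
have m0 : 0 <= m by apply: mean_ge0.
have /card_gt0P[k _] := C_gt0.
have := second_moment_le r C_gt0 degree_linear.
rewrite -/m mulrDr -expr2 -lerBlDl => var.
have : mean (fun X : Om => (copy_count K X == 0)%:R) * m ^+ 2 <= m * K1.
  apply: le_trans var; rewrite mulrC -meanZ.
  rewrite -(mean_sqr_dev [ffun=> k] (fun X : Om => (copy_count K X)%:R)).
  apply: le_mean => X; case: eqP => [->|_]; last by rewrite mulr0 sqr_ge0.
  by rewrite mulr1 sub0r sqrrN.
rewrite expr2 mulrCA.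
move: m0; rewrite le_eqVlt => /predU1P[<- _|m0].
  by rewrite divr_ge0 ?touching_ge0 ?degree_slope_ge0// ltW.
rewrite ler_pM2l// => h; rewrite /B ler_pdivlMr// mulrC.
by rewrite (le_trans _ h)// ler_wpM2r// ltW.
Qed.

Lemma third_moment_bounded :
  mean (fun X : Om => (copy_count K X)%:R ^+ 3) <= B * (B + K1) * (B + K2).
Proof.
apply: le_trans (third_moment_le r C_gt0 degree_slope_ge0 degree_linear) _.
have m0 : 0 <= mean (fun X : Om => (copy_count K X)%:R : R) by apply: mean_ge0.
have mB := mean_stars_bounded.
have K10 : 0 <= K1 by rewrite touching_ge0// degree_slope_ge0.
have K20 : 0 <= K2 by rewrite touching_ge0// degree_slope_ge0.
have Bge0 := le_trans m0 mB.
move: (mean _) m0 mB => m m0 mB.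
apply: ler_pM; rewrite ?lerD2r ?mulr_ge0 ?addr_ge0//.
by apply: ler_pM; rewrite ?lerD2r ?addr_ge0.
Qed.

End no_star.

Section moment_limits.
Local Open Scope classical_set_scope.
Local Open Scope ring_scope.
Variables (R : realType) (lambda : R).
Hypothesis lambda_gt0 : 0 < lambda.
Variables (W : nat -> finType) (T : forall n, W n -> nat).
Arguments T : clear implicits.
Hypothesis pmf_cvg : forall k,
  mean (fun w => (T n w == k)%:R : R) @[n --> \oo] --> poisson_pmf lambda k.

(** A bounded third moment makes the contribution of large values to moments of
    order at most two uniformly small. *)
Lemma moment_cvg (B l : R) (f : nat -> R) :
  (\forall n \near \oo, mean (fun w => (T n w)%:R ^+ 3 : R) <= B) ->
  (forall k, 0 <= f k <= k%:R ^+ 2) ->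
  \sum_(k < M) f k * poisson_pmf lambda k @[M --> \oo] --> l ->
  mean (fun w => f (T n w)) @[n --> \oo] --> l.
Proof.
move=> T3 f2 fl.
suff h : mean (fun w => f (T n w)) - l @[n --> \oo] --> 0.
  have -> : (fun n => mean (fun w => f (T n w))) =
      (fun n => (mean (fun w => f (T n w)) - l) + l).
    by apply/funext => n; rewrite subrK.
  by rewrite -[X in _ --> X]add0r; apply: cvgD => //; exact: cvg_cst.
have C0 : 0 < `|B| + 2 by rewrite ltr_wpDl.
apply: (cvg0_eps C0) => e e0.
have [M [M0 Me fM]] : exists M, [/\ (0 < M)%N, M%:R^-1 <= e &
    `|l - \sum_(k < M) f k * poisson_pmf lambda k| <= e].
  have [N _ hN] : \forall M \near \oo, (0 < M)%N /\ (M%:R^-1 <= e /\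
      `|l - \sum_(k < M) f k * poisson_pmf lambda k| <= e).
    near=> M; split; first by near: M; exact: nbhs_infty_gt.
    split; last by near: M; exact: (cvgr_dist_le _ _ fl).
    rewrite invf_ple ?posrE// ?ltr0n; last by near: M; exact: nbhs_infty_gt.
    by near: M; exact: nbhs_infty_ger.
  by have [] := hN N (leqnn N) => ? [? ?]; exists N.
have partial : \sum_(k < M) f k * mean (fun w => (T n w == k)%:R : R) @[n --> \oo]
    --> \sum_(k < M) f k * poisson_pmf lambda k.
  elim: M {M0 Me fM} => [|M IH].
    by under eq_fun do rewrite big_ord0; rewrite big_ord0; exact: cvg_cst.
  under eq_fun do rewrite big_ord_recr/=; rewrite big_ord_recr/=.
  by apply: cvgD => //; apply: cvgM; [exact: cvg_cst|exact: pmf_cvg].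
near=> n.
have T3n : mean (fun w => (T n w)%:R ^+ 3 : R) <= B by near: n.
pose S := \sum_(k < M) f k * mean (fun w => (T n w == k)%:R : R).
have SE : S = mean (fun w => (T n w < M)%:R * f (T n w)).
  rewrite /S; under eq_bigr do rewrite -meanZ.
  rewrite -mean_sum; apply: eq_mean => w.
  case: ltnP => wM.
    rewrite (bigD1 (Ordinal wM))//= eqxx mul1r mulr1 big1 ?addr0// => i /eqP ix.
    by case: eqP => [e1|]; rewrite ?mulr0//; case: ix; apply/val_inj.
  rewrite mul0r big1// => i _; case: eqP => [e1|]; rewrite ?mulr0//.
  by have := ltn_ord i; rewrite -e1 ltnNge wM.
have tail : `|mean (fun w => f (T n w)) - S| <= `|B| * e.
  rewrite SE -meanB (le_trans (norm_mean _))//.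
  apply: (@le_trans _ _ (M%:R^-1 * mean (fun w => (T n w)%:R ^+ 3))); last first.
    rewrite mulrC ler_pM// ?invr_ge0//; last by rewrite (le_trans T3n)// ler_norm.
    by apply: mean_ge0 => w; rewrite exprn_ge0.
  rewrite -meanZ; apply: le_mean => w; have /andP[fw0 fw2] := f2 (T n w).
  case: ltnP => [_|Mw].
    by rewrite mul1r subrr normr0 mulr_ge0// ?invr_ge0// exprn_ge0.
  rewrite mul0r subr0 ger0_norm// (le_trans fw2)// ler_pdivlMl ?ltr0n//.
  by rewrite [leRHS]exprS ler_wpM2r ?exprn_ge0// ler_nat.
have -> : mean (fun w => f (T n w)) - l = (mean (fun w => f (T n w)) - S) +
   ((S - \sum_(k < M) f k * poisson_pmf lambda k) -
    (l - \sum_(k < M) f k * poisson_pmf lambda k)) by ring.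
rewrite (le_trans (ler_normD _ _))// mulrDl lerD//.
rewrite (le_trans (ler_normB _ _))// mulrDl mul1r lerD//.
by rewrite /S distrC; near: n; exact: (cvgr_dist_le _ _ partial).
Unshelve. all: by end_near. Qed.

Lemma poisson_pmfS k :
  k.+1%:R * poisson_pmf lambda k.+1 = lambda * poisson_pmf lambda k.
Proof.
rewrite !poisson_pmfE// factS natrM exprS; field.
by rewrite nat1r !pnatr_eq0/= -lt0n fact_gt0.
Qed.

Lemma cvg_poisson_mean :
  \sum_(k < M) k%:R * poisson_pmf lambda k @[M --> \oo] --> lambda.
Proof.
rewrite -cvg_shiftS/=.
under eq_fun do rewrite big_ord_recl/= mul0r add0r.
have -> : (fun n => \sum_(i < n) (bump 0 i)%:R * poisson_pmf lambda (bump 0 i)) =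
    (fun n => lambda * \sum_(i < n) poisson_pmf lambda i).
  by apply/funext => n; rewrite mulr_sumr; apply: eq_bigr => i _; exact: poisson_pmfS.
suff : lambda * \sum_(i < n) poisson_pmf lambda i @[n --> \oo] --> lambda * 1.
  by rewrite mulr1.
by apply: cvgM; [exact: cvg_cst|exact: cvg_sum_poisson].
Qed.

Lemma cvg_poisson_factorial2 :
  \sum_(k < M) (k * k.-1)%:R * poisson_pmf lambda k @[M --> \oo] --> lambda ^+ 2.
Proof.
rewrite -cvg_shiftS/=.
under eq_fun do rewrite big_ord_recl/= mul0r add0r.
have -> : (fun n => \sum_(i < n) (bump 0 i * i)%:R * poisson_pmf lambda (bump 0 i)) =
    (fun n => lambda * \sum_(i < n) i%:R * poisson_pmf lambda i).
  apply/funext => n; rewrite mulr_sumr; apply: eq_bigr => i _.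
  by rewrite natrM mulrAC poisson_pmfS mulrAC mulrA.
by rewrite expr2; apply: cvgM; [exact: cvg_cst|exact: cvg_poisson_mean].
Qed.

End moment_limits.

Section only_if.
Local Open Scope classical_set_scope.
Local Open Scope ring_scope.
Variables (R : realType) (lambda : R) (r : nat) (G : nat -> sgraph) (c : nat -> nat).
Hypothesis lambda_gt0 : 0 < lambda.
Hypothesis r_gt0 : (0 < r)%N.
Local Notation K := (star r).
Local Notation m := (count_mean R K G c).

Lemma card_colors n : (0 < #|'I_(c n).-1.+1|)%N.
Proof. by rewrite card_ord. Qed.

(** The limit of [P(T = 0)] is positive, which bounds in turn the degrees, the mean
    and the third moment. *)
Lemma stars_moments_cvg :
  (forall k, pmf R K G c n k @[n --> \oo] --> poisson_pmf lambda k) ->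
  m n @[n --> \oo] --> lambda /\
  count_variance R K G c n @[n --> \oo] --> lambda.
Proof.
move=> pcvg.
pose delta := poisson_pmf lambda 0 / 2.
have p0 : 0 < poisson_pmf lambda 0.
  by rewrite poisson_pmfE// expr0 fact0 divr1 mulr1 expR_gt0.
have delta0 : 0 < delta by rewrite divr_gt0.
have [B T3] : exists B : R, \forall n \near \oo,
    mean (fun w : coloring_seq G c n => (copy_count K w)%:R ^+ 3 : R) <= B.
  eexists; near=> n.
  apply: (third_moment_bounded (card_colors n) r_gt0 delta0).
  near: n; apply: (cvgr_ge _ (pcvg 0%N)).
  by rewrite ltr_pdivrMr// ltr_pMr// ltr1n.
have m1 : m n @[n --> \oo] --> lambda.
  apply: (moment_cvg pcvg T3 (f := fun k => k%:R)); last exact: cvg_poisson_mean.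
  by case=> [|k]; rewrite ?expr0n ?lexx//= ler0n ler_eXnr// ler1n.
pose f2 n : R := mean (fun w : coloring_seq G c n =>
  (copy_count K w * (copy_count K w).-1)%:R).
have m2 : f2 n @[n --> \oo] --> lambda ^+ 2.
  apply: (moment_cvg pcvg T3 (f := fun k => (k * k.-1)%:R)).
    by move=> k; rewrite ler0n/= natrM expr2 ler_wpM2l// ler_nat leq_pred.
  exact: cvg_poisson_factorial2.
split=> //.
have -> : count_variance R K G c = (fun n => f2 n + (m n - m n ^+ 2)).
  apply/funext => n.
  rewrite /count_variance (mean_sqr_dev [ffun=> ord0]) -/(m n) addrA -meanD.
  congr (_ - _); apply: eq_mean => w.
  case: (copy_count K w) => [|k]; first by rewrite mul0n; ring.
  by rewrite /= natrM -natr1; ring.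
rewrite -[X in _ --> X](subrK (lambda ^+ 2)) addrC; apply: cvgD => //.
by apply: cvgB => //; rewrite expr2; exact: cvgM.
Unshelve. all: by end_near. Qed.

End only_if.

(** * Chen's bound for families of monochromatic copies *)

Section family.
Variables (R : realType) (V C H I : finType) (S : {set I}).
Variables (s : I -> H -> V) (pivot : I -> H).
Local Notation Om := {ffun V -> C}.
Hypothesis C_gt0 : (0 < #|C|)%N.
Hypothesis H_gt1 : (1 < #|H|)%N.
Hypothesis s_inj : forall i, i \in S -> injective (s i).

(** The pivot may be any vertex of the copy: whether the copy is monochromatic is
    independent of the colors of the pivot and of all vertices outside the copy. *)
Definition touches i j := ~~ [disjoint span (s j) & span (s i) :\ s i (pivot i)].

Definition family_count (X : Om) : nat := \sum_(i in S) monochromatic (s i) X.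
Local Notation T := family_count.

Lemma family_chen (h : nat -> R) : (forall k, 0 <= h k <= 1) ->
  `|mean (fun X => (T X)%:R * h (T X)) -
    mean (fun X => (T X)%:R : R) * mean (fun X => h (T X).+1)| <=
  \sum_(i in S) (\sum_(j in S | touches i j && (j != i))
     mean (fun X : Om => (monochromatic (s i) X)%:R * (monochromatic (s j) X)%:R : R) +
   \sum_(j in S | touches i j) (#|C|%:R^-1 ^+ #|H|.-1) ^+ 2).
Proof.
move=> h01.
have p_mono i : i \in S -> mean (fun X : Om => (monochromatic (s i) X)%:R : R) =
    #|C|%:R^-1 ^+ #|H|.-1.
  by move=> iS; rewrite mean_monochromatic ?(ltnW H_gt1)//; exact: s_inj.
apply: le_trans
  (@chen_bound R _ I S (fun i => @monochromatic V C H (s i)) touches _ _ h h01) _.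
- move=> i iS; rewrite /touches -setI_eq0; apply/set0Pn.
  have [a ai] : exists a, a != pivot i.
    have := cardC1 (pivot i); rewrite -[in RHS](prednK (ltnW H_gt1)) /=.
    move=> e; have : (0 < #|predC1 (pivot i)|)%N by rewrite e; case: #|H| H_gt1 => [|[|]].
    by move=> /card_gt0P[a aP]; exists a.
  exists (s i a); rewrite !inE mem_span (inj_eq (s_inj iS)) ai.
  done.
- move=> i iS g; rewrite p_mono// mulrC.
  rewrite -(@mean_monochromaticZ R V C H (s i) (pivot i) (~: (span (s i) :\ s i (pivot i)))).
  + by apply: eq_mean => X; rewrite mulrC.
  + exact: s_inj.
  + move=> X Y XY; congr g; apply: eq_bigr => j /andP[_]; rewrite negbK => dj.
    congr nat_of_bool; apply: span_monochromatic => x xj; apply: XY.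
    by rewrite inE; rewrite (disjointFr dj xj).
  + by rewrite -setI_eq0 finset.setICr.
- apply: ler_sum => i iS; rewrite lerD2l; apply: ler_sum => j /andP[jS _].
  by rewrite !p_mono// expr2.
Qed.

End family.

Section covariances.
Variables (R : realType) (H G : sgraph) (C : finType).
Hypothesis C_gt0 : (0 < #|C|)%N.
Hypothesis H_gt0 : (0 < #|H|)%N.
Local Notation Om := {ffun G -> C}.
Let p : R := #|C|%:R^-1 ^+ #|H|.-1.

Definition joint (s t : {ffun H -> G}) : R :=
  mean (fun X : Om => (monochromatic s X)%:R * (monochromatic t X)%:R).

Let C1 : #|C|%:R^-1 <= 1 :> R.
Proof. by rewrite invf_le1 ?ltr0n// ler1n. Qed.

Let Ci0 : 0 <= #|C|%:R^-1 :> R. Proof. by rewrite invr_ge0. Qed.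

(** A common vertex can only reduce the number of vertices that the second copy
    adds, and disjoint copies are independent. *)
Lemma joint_ge (s t : {ffun H -> G}) : injective s -> injective t ->
  p ^+ 2 <= joint s t.
Proof.
move=> si ti; rewrite /joint.
have [dst|] := boolP [disjoint span t & span s].
  have /card_gt0P[a _] := H_gt0.
  rewrite (mean_monochromaticZ (a := a) (U := span s) ti) ?mean_monochromatic//.
    by move=> X Y XY; rewrite (span_monochromatic XY).
  by apply: disjointWl dst; exact: subsetDl.
rewrite -setI_eq0 => /set0Pn[x]; rewrite inE => /andP[/imsetP[b _ xb] /imsetP[a _ xa]].
rewrite (mean_monochromaticI R C_gt0 (a := a) (b := b) si); last by rewrite -xa.
rewrite expr2; apply: ler_wpM2l; first exact: exprn_ge0.
apply: ler_wiXn2l => //.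
rewrite -ltnS prednK// -(card_imset predT ti); apply: proper_card.
apply/properP; split; first exact: subsetDl.
by exists x; rewrite ?inE ?xb ?mem_span// -xb xa mem_span.
Qed.

(** The diagonal covariances add up to the mean, apart from [m * p]. *)
Lemma variance_copy_count (m := mean (fun X : Om => (copy_count H X)%:R : R)) :
  mean (fun X : Om => ((copy_count H X)%:R - m) ^+ 2) - m + m * p =
  \sum_(s in copies H G) \sum_(t in copies H G | t != s) (joint s t - p ^+ 2).
Proof.
have /card_gt0P[k _] := C_gt0.
have mE : m = \sum_(s in copies H G) p.
  by rewrite /m mean_copy_count// sumr_const mulr_natl.
transitivity (\sum_(s in copies H G) \sum_(t in copies H G) (joint s t - p ^+ 2)
   - m + m * p).
  congr (_ - _ + _).
  transitivity (mean (fun X : Om => (copy_count H X)%:R ^+ 2) - m ^+ 2).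
    exact: (mean_sqr_dev [ffun=> k]).
  under [RHS]eq_bigr do rewrite sumrB.
  rewrite sumrB; congr (_ - _).
    under [RHS]eq_bigr do rewrite -mean_sum.
    rewrite -mean_sum; apply: eq_mean => X; rewrite /copy_count natr_sum expr2 mulr_suml.
    by apply: eq_bigr => s _; rewrite mulr_sumr.
  rewrite expr2 mE mulr_suml; apply: eq_bigr => s _; rewrite mulr_sumr.
  by apply: eq_bigr => t _; rewrite expr2.
rewrite mE mulr_suml -!sumrB -big_split/=; apply: eq_bigr => s sc.
rewrite (bigD1 s)//=.
have -> : joint s s = p.
  apply: etrans (mean_monochromatic R C_gt0 H_gt0 (@copies_injective _ _ _ sc)).
  by apply: eq_mean => X; rewrite -natrM mulnb andbb.
by ring.
Qed.

End covariances.

(** * Small variance excess forces small degrees *)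

Lemma ffact_ge n k : ((n - k) ^ k <= n ^_ k)%N.
Proof.
rewrite ffact_prod -[X in (_ ^ X <= _)%N]card_ord -prod_nat_const.
by apply: leq_prod => i _; rewrite leq_sub2l// ltnW.
Qed.

Section star_variance.
Variables (R : realType) (r : nat) (G : sgraph) (C : finType).
Hypothesis C_gt1 : (1 < #|C|)%N.
Hypothesis r_gt1 : (1 < r)%N.
Local Notation K := (star r).
Local Notation Om := {ffun G -> C}.
Let C_gt0 : (0 < #|C|)%N := ltnW C_gt1.
Let c : R := #|C|%:R.
Let o : K := (ord0 : 'I_r.+1).
Let l : K := (Ordinal (ltnW r_gt1 : (1 < r.+1)%N) : 'I_r.+1).
Let a := #|automorphisms K|.

Definition stars_at (v : G) : {set {ffun K -> G}} :=
  [set s in embeddings K G | s o == v].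

Lemma card_stars_at_ge v :
  (#|neighbors v| ^_ r <= #|stars_at v|)%N.
Proof.
pose F := [set f : {ffun 'I_r -> G} | f \in ffun_on (mem (neighbors v)) & injectiveb f].
have <- : #|F| = (#|neighbors v| ^_ r)%N.
  by rewrite card_inj_ffuns_on card_ord.
pose st (f : {ffun 'I_r -> G}) : {ffun K -> G} :=
  [ffun i : K => if unlift (ord0 : 'I_r.+1) i is Some j then f j else v].
have st_inj : injective st.
  move=> f g fg; apply/ffunP => j.
  have := congr1 (fun h : {ffun K -> G} => h (lift (ord0 : 'I_r.+1) j)) fg.
  by rewrite !ffunE liftK.
rewrite -(card_imset _ st_inj); apply: subset_leq_card.
apply/fintype.subsetP => s /imsetP[f]; rewrite inE => /andP[/ffun_onP fN /injectiveP fi] ->.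
have f_adj j : adj v (f j) by have := fN j; rewrite inE.
have fv j : f j != v.
  by apply/eqP => e; have := f_adj j; rewrite e adj_irrefl.
have st0 : st f o = v by rewrite ffunE unlift_none.
have stl (j : 'I_r) : st f (lift (ord0 : 'I_r.+1) j) = f j by rewrite ffunE liftK.
rewrite inE st0 eqxx andbT; apply/star_embeddings; split.
  move=> i j; case: (unliftP (ord0 : 'I_r.+1) i) => [i'|] ->;
    case: (unliftP (ord0 : 'I_r.+1) j) => [j'|] ->; rewrite ?stl ?st0//.
  - by move=> /fi ->.
  - by move=> /eqP; rewrite (negbTE (fv _)).
  - by move=> /esym/eqP; rewrite (negbTE (fv _)).
move=> i; case: (unliftP (ord0 : 'I_r.+1) i) => [i'|] ->; last by rewrite eqxx.
by rewrite stl -/o st0.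
Qed.

Local Notation q := (c^-1).

Lemma joint_shared_edge (s t : {ffun K -> G}) :
  s \in embeddings K G -> t \in embeddings K G -> s o = t o -> s l = t l ->
  q ^+ (r + r.-1) * (1 - q) <= joint R C s t - (q ^+ r) ^+ 2.
Proof.
move=> /embeddingsP[si _] /embeddingsP[ti _] st0 st1.
have c0 : 0 < c by rewrite ltr0n.
have q1 : q <= 1 by rewrite invf_le1// /c ler1n.
have q0 : 0 <= q by rewrite invr_ge0 ltW.
rewrite /joint (mean_monochromaticI R C_gt0 (a := o) (b := o) si)// card_star /=.
rewrite -/c.
have -> : q ^+ (r + r.-1) * (1 - q) = q ^+ r * q ^+ r.-1 - (q ^+ r) ^+ 2.
  rewrite mulrBr mulr1 exprD -mulrA -exprSr expr2; congr (_ - _ * _ ^+ _).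
  by rewrite prednK// ltnW.
rewrite lerD2r; apply: ler_wpM2l; first exact: exprn_ge0.
apply: ler_wiXn2l => //.
have sub : [set t o; t l] \subset span t :&: span s.
  apply/fintype.subsetP => x; rewrite !inE => /orP[] /eqP ->;
  by rewrite mem_span -?st0 -?st1 mem_span.
have := subset_leq_card sub; rewrite cards2 (inj_eq ti).
have -> : o != l by [].
have := cardsD (span t) (span s); rewrite card_imset// card_star => -> h.
rewrite leq_subLR -subn1 addnBA ?(ltnW r_gt1)//.
by rewrite (leq_trans _ (leq_sub2r 1 (leq_add h (leqnn r))))// add2n subn1.
Qed.

Let D : R := \sum_(s in copies K G) \sum_(t in copies K G | t != s)
  (joint R C s t - (q ^+ r) ^+ 2).

Lemma sum_shared_edge_le v :
  q ^+ (r + r.-1) * (1 - q) *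
    (\sum_(u : G) #|[set s in stars_at v | s l == u]|%:R ^+ 2 -
     #|stars_at v|%:R * a%:R) <= a%:R ^+ 2 * D.
Proof.
pose f (s t : {ffun K -> G}) : R :=
  (~~ same_copy s t)%:R * (joint R C s t - (q ^+ r) ^+ 2).
have f_ge0 s t : s \in embeddings K G -> t \in embeddings K G -> 0 <= f s t.
  move=> /embeddingsP[si _] /embeddingsP[ti _]; rewrite mulr_ge0// subr_ge0.
  have := @joint_ge R K G C C_gt0; rewrite card_star; exact.
have sameE s t g : g \in automorphisms K ->
    same_copy s (precomp t g) = same_copy s t.
  move=> gA; have tg : same_copy t (precomp t g) by apply/same_copyP; exists g.
  apply/idP/idP => h; last exact: same_copy_trans h tg.
  by apply: same_copy_trans h _; rewrite same_copy_sym.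
have jointE s t g : joint R C s (precomp t g) = joint R C s t.
  by apply: eq_mean => X; rewrite monochromatic_precomp.
have jointE' s t g : joint R C (precomp s g) t = joint R C s t.
  by apply: eq_mean => X; rewrite monochromatic_precomp.
have -> : a%:R ^+ 2 * D = \sum_(s in embeddings K G) \sum_(t in embeddings K G) f s t.
  rewrite (eq_bigr (fun s => a%:R * \sum_(t in copies K G) f s t)); last first.
    by move=> s _; apply: sum_embeddings => t g gA; rewrite /f sameE// jointE.
  rewrite -mulr_sumr sum_embeddings; last first.
    move=> s g gA; apply: eq_bigr => t _.
    by rewrite /f jointE' ![same_copy _ t]same_copy_sym sameE.
  rewrite mulrA expr2; congr (_ * _); apply: eq_bigr => s sc.
  rewrite big_mkcondr/=; apply: eq_bigr => t tc; rewrite /f.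
  have -> : same_copy s t = (t == s).
    apply/idP/eqP => [st|->]; last exact: same_copy_refl.
    by rewrite (copies_eq sc tc st).
  by case: eqP; rewrite ?mul0r ?mul1r.
have c0 : 0 < c by rewrite ltr0n.
have w0 : 0 <= q ^+ (r + r.-1) * (1 - q).
  rewrite mulr_ge0// ?exprn_ge0 ?invr_ge0 ?(ltW c0)// subr_ge0.
  by rewrite invf_le1// /c ler1n.
apply: (@le_trans _ _
  (\sum_(s in stars_at v) \sum_(t in stars_at v | t l == s l) f s t)); last first.
  rewrite big_mkcond [leRHS]big_mkcond/= ler_sum// => s _; rewrite [s \in stars_at v]inE.
  case: ifP => [/andP[sE _]|_]; last first.
    by case: ifP => // sE; apply: sumr_ge0 => t tE; exact: f_ge0.
  rewrite sE big_mkcond [leRHS]big_mkcond/= ler_sum// => t _; rewrite [t \in stars_at v]inE.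
  case: ifP => [/andP[/andP[-> _] _]//|_].
  by case: ifP => // tE; exact: f_ge0.
apply: (@le_trans _ _ (\sum_(s in stars_at v) \sum_(t in stars_at v | t l == s l)
    q ^+ (r + r.-1) * (1 - q) * (~~ same_copy s t)%:R)); last first.
  apply: ler_sum => s; rewrite inE => /andP[sE /eqP s0].
  apply: ler_sum => t; rewrite inE => /andP[/andP[tE /eqP t0] /eqP tl].
  by rewrite mulrC ler_wpM2l// joint_shared_edge// ?s0 ?t0.
under [leRHS]eq_bigr do rewrite -mulr_sumr.
rewrite -mulr_sumr ler_wpM2l//.
have -> : \sum_(u : G) #|[set s in stars_at v | s l == u]|%:R ^+ 2 =
    \sum_(s in stars_at v) \sum_(t in stars_at v | t l == s l) 1 :> R.
  rewrite (partition_big (fun s : {ffun K -> G} => s l) predT)//=.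
  apply: eq_bigr => u _; rewrite expr2 -sum1_card natr_sum.
  rewrite mulr_suml; apply: eq_big => [s|s]; first by rewrite !inE.
  rewrite inE => /andP[_ /eqP su]; rewrite mul1r; apply: eq_bigl => t.
  by rewrite inE su.
rewrite lerBlDl mulr_natl -sumr_const -big_split/=; apply: ler_sum => s.
rewrite inE => /andP[/embeddingsP[si _] _].
have -> : a%:R = \sum_(t in [set t | @same_copy K G s t]) 1 :> R.
  by rewrite sumr_const (@card_same_copy K G s si).
rewrite big_mkcond [X in _ <= X + _]big_mkcond [X in _ <= _ + X]big_mkcond/= -big_split/=.
apply: ler_sum => t _; rewrite !inE.
by case: ifP => _; case: (@same_copy K G s t) => /=; rewrite ?addr0 ?add0r ?lexx ?ler01.
Qed.

(** Once a degree is large, pairs of distinct stars sharing the center and a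
    leaf already make the excess of the variance over the mean of order
    [(degree / #|C|) ^ (2r - 1)]; the Cauchy-Schwarz inequality over the shared
    leaf counts these pairs. *)
Lemma degree_excess (v : G) : (8 * a + 2 * r <= #|neighbors v|)%N ->
  (#|neighbors v|%:R / c) ^+ (r + r.-1) <= 4 ^+ r.+1 * a%:R ^+ 2 * D.
Proof.
set d := #|neighbors v| => d_ge.
have c0 : 0 < c by rewrite ltr0n.
have a0 : (0 < a)%N by exact: card_automorphisms_gt0.
have d0 : (0 < d)%N.
  by apply: leq_trans d_ge; rewrite addn_gt0 muln_gt0 a0.
have d8 : (8 * a <= d)%N by apply: leq_trans d_ge; rewrite leq_addr.
have d2r : (2 * r <= d)%N by apply: leq_trans d_ge; rewrite leq_addl.
have dR : 0 < d%:R :> R by rewrite ltr0n.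
have q2 : q <= 2^-1 by rewrite lef_pV2 ?posrE// /c ler_nat.
pose N : R := #|stars_at v|%:R.
have NE : N = \sum_(u in neighbors v) #|[set s in stars_at v | s l == u]|%:R.
  rewrite /N -sum1_card natr_sum.
  rewrite (partition_big (fun s : {ffun K -> G} => s l) (mem (neighbors v)))/=; last first.
    move=> s; rewrite inE => /andP[sE /eqP sv].
    have [_ h] := elimT (@star_embeddings r G s) sE.
    by rewrite inE -sv; exact: h.
  apply: eq_bigr => u _; rewrite -sum1_card natr_sum.
  by apply: eq_bigl => s; rewrite inE.
(* Cauchy-Schwarz: sum the squared deviations from the average N / d *)
have CS : N ^+ 2 <= d%:R * \sum_(u : G) #|[set s in stars_at v | s l == u]|%:R ^+ 2.
  pose y := N / d%:R.
  have : 0 <= \sum_(u in neighbors v) (#|[set s in stars_at v | s l == u]|%:R - y) ^+ 2.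
    by apply: sumr_ge0 => u _; exact: sqr_ge0.
  rewrite (eq_bigr (fun u => #|[set s in stars_at v | s l == u]|%:R ^+ 2 +
    (- (2 * y) * #|[set s in stars_at v | s l == u]|%:R + y ^+ 2))); last first.
    by move=> u _; ring.
  rewrite 2!big_split/= -mulr_sumr -NE sumr_const -[_ *+ _]mulr_natl -/d => h.
  have e : \sum_(u in neighbors v) #|[set s in stars_at v | s l == u]|%:R ^+ 2 <=
     \sum_(u : G) #|[set s in stars_at v | s l == u]|%:R ^+ 2 :> R.
    by rewrite big_mkcond/= ler_sum// => u _; case: ifP => // _; exact: sqr_ge0.
  have : N ^+ 2 <= d%:R * \sum_(u in neighbors v) #|[set s in stars_at v | s l == u]|%:R ^+ 2.
    rewrite -ler_pdivrMl// mulrC.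
    have -> : N ^+ 2 / d%:R = 2 * y * N - d%:R * y ^+ 2.
      by rewrite /y; field; rewrite gt_eqF.
    by lra.
  by move=> h'; rewrite (le_trans h')// ler_wpM2l// ltW.
have Nd : (d%:R / 2) ^+ r <= N.
  apply: (@le_trans _ _ ((d - r) ^ r)%:R); last first.
    by rewrite ler_nat (leq_trans (ffact_ge d r))// card_stars_at_ge.
  rewrite natrX lerXn2r ?nnegrE ?divr_ge0//.
  rewrite natrB; last by rewrite (leq_trans _ d2r)// leq_pmull.
  have : (2 * r)%:R <= d%:R :> R by rewrite ler_nat.
  by rewrite natrM => ?; lra.
have Nad : 2 * a%:R * d%:R <= N.
  apply: le_trans Nd; apply: (@le_trans _ _ ((d%:R / 2) ^+ 2)).
    have : (8 * a)%:R <= d%:R :> R by rewrite ler_nat.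
    rewrite natrM expr2 mulrA => ad.
    have -> : d%:R / 2 * d%:R / 2 = d%:R / 4 * d%:R :> R by field.
    by rewrite ler_wpM2r//; lra.
  apply: ler_weXn2l => //; rewrite ler_pdivlMr// mul1r ler_nat.
  by rewrite (leq_trans _ d2r)// leq_pmulr// ltnW.
have excess := sum_shared_edge_le v; rewrite -/N in excess.
set Q := \sum_(u : G) _ in excess CS.
have w0 : 0 < q ^+ (r + r.-1) by rewrite exprn_gt0// invr_gt0.
have key : N ^+ 2 / (2 * d%:R) <= Q - N * a%:R.
  have h1 : N ^+ 2 / d%:R <= Q by rewrite ler_pdivrMr// mulrC.
  have h2 : N * a%:R <= N ^+ 2 / (2 * d%:R).
    rewrite expr2 -mulrA ler_wpM2l// ler_pdivlMr ?mulr_gt0//.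
    by move: Nad; rewrite mulrCA mulrA.
  have h3 : N ^+ 2 / d%:R = N ^+ 2 / (2 * d%:R) + N ^+ 2 / (2 * d%:R).
    by field; rewrite gt_eqF.
  by lra.
have key2 : (d%:R / 2) ^+ (r + r) / (2 * d%:R) <= Q - N * a%:R.
  apply: le_trans key; rewrite ler_wpM2r ?invr_ge0 ?mulr_ge0//.
  by rewrite exprD expr2 ler_pM// exprn_ge0// divr_ge0.
have : q ^+ (r + r.-1) * 2^-1 * ((d%:R / 2) ^+ (r + r) / (2 * d%:R)) <= a%:R ^+ 2 * D.
  apply: le_trans excess; apply: ler_pM key2.
  - by rewrite mulr_ge0// ltW.
  - by rewrite divr_ge0 ?exprn_ge0 ?divr_ge0 ?mulr_ge0// ltW.
  - by rewrite ler_wpM2l ?(ltW w0)//; lra.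
have -> : q ^+ (r + r.-1) * 2^-1 * ((d%:R / 2) ^+ (r + r) / (2 * d%:R)) =
    (d%:R / c) ^+ (r + r.-1) / 4 ^+ r.+1.
  have rr : (r + r = (r + r.-1).+1)%N by rewrite -addnS prednK// ltnW.
  have -> : 4 ^+ r.+1 = 8 * 2 ^+ (r + r.-1) :> R.
    rewrite -!natrX -natrM; congr _%:R.
    rewrite -[4%N]/(2 ^ 2)%N -[8%N]/(2 ^ 3)%N -expnM -expnD; congr (_ ^ _)%N.
    by rewrite mulnS mul2n -addnn rr.
  rewrite rr [(d%:R / 2) ^+ _.+1]exprS !expr_div_n exprVn.
  have : c ^+ (r + r.-1) != 0 by rewrite expf_neq0 ?gt_eqF.
  have : 2 ^+ (r + r.-1) != 0 :> R by rewrite expf_neq0.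
  move: (c ^+ _) (2 ^+ _) (d%:R ^+ _) => x y z y0 x0.
  have dn0 : d%:R != 0 :> R by rewrite gt_eqF.
  move: (d%:R : R) dn0 => e e0; field.
  by rewrite x0 y0 e0.
by rewrite ler_pdivrMr ?exprn_gt0// [X in _ <= X -> _]mulrC mulrA.
Qed.

End star_variance.

(** * Stars with at least two leaves *)

Section star_chen.
Variables (R : realType) (r : nat) (G : sgraph) (C : finType) (eps : R).
Hypothesis C_gt0 : (0 < #|C|)%N.
Hypothesis r_gt0 : (0 < r)%N.
Hypothesis eps_ge0 : 0 <= eps.
Hypothesis degree_le : forall v : G, #|neighbors v|%:R <= eps * #|C|%:R.
Local Notation K := (star r).
Local Notation Om := {ffun G -> C}.
Local Notation T := (fun X : Om => copy_count K X).
Local Notation q := (#|C|%:R^-1 : R).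
Local Notation m := (mean (fun X : Om => (T X)%:R : R)).

(** Pairs of stars with a common vertex are counted with the probability of
    independent copies, where small degrees make them rare, plus their
    covariances, which the excess of the variance over the mean adds up. *)
Lemma star_chen_bound (h : nat -> R) : (forall k, 0 <= h k <= 1) ->
  `|mean (fun X => (T X)%:R * h (T X)) - m * mean (fun X => h (T X).+1)| <=
  (mean (fun X => ((T X)%:R - m) ^+ 2) - m + m * q ^+ r) +
  2 * r.+1%:R ^+ 2 * m * eps ^+ r.
Proof.
move=> h01.
have c0 : 0 < #|C|%:R :> R by rewrite ltr0n.
have K_gt1 : (1 < #|K|)%N by rewrite card_star ltnS.
have inj (s : {ffun K -> G}) : s \in copies K G -> injective (fun a => s a).
  exact: copies_injective.
have := @family_chen R G C K _ (copies K G) (fun s a => s a)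
  (fun=> (ord0 : 'I_r.+1) : K) C_gt0 K_gt1 inj h h01.
have := @variance_copy_count R K G C C_gt0 (ltnW K_gt1).
rewrite card_star => /= -> /le_trans; apply.
have -> : 2 * r.+1%:R ^+ 2 * m * eps ^+ r =
    \sum_(s in copies K G) 2 * (r.+1%:R ^+ 2 * eps ^+ r * q ^+ r).
  rewrite mean_copy_count// ?(ltnW K_gt1)// card_star/= sumr_const -[_ *+ _]mulr_natl.
  by ring.
rewrite -big_split/=; apply: ler_sum => s sc.
have si := @copies_injective K G s sc.
pose U := span s :\ s ((ord0 : 'I_r.+1) : K).
have near_count : \sum_(t in copies K G | ~~ [disjoint span t & U]) (q ^+ r) ^+ 2 <=
    r.+1%:R ^+ 2 * eps ^+ r * q ^+ r.
  apply: (@le_trans _ _ ((q ^+ r) ^+ 2 *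
      \sum_(t in embeddings K G | ~~ [disjoint span t & U]) \prod_(j : K) 1)).
    rewrite mulr_sumr [leLHS]big_mkcond [leRHS]big_mkcond/= ler_sum// => t _.
    rewrite big1// mulr1.
    case: ifP => [/andP[/(@copies_embeddings K G) -> ->]//|_].
    by case: ifP => // _; rewrite exprn_ge0// exprn_ge0// invr_ge0.
  have meet : \sum_(t in embeddings K G | ~~ [disjoint span t & U]) \prod_(j : K) 1 <=
      r.+1%:R * #|U|%:R * (eps * #|C|%:R) ^+ r :> R.
    have -> : #|U|%:R = \sum_(u in U) 1 :> R by rewrite sumr_const.
    by apply: sum_star_meeting => // v; rewrite sumr_const.
  apply: (le_trans (ler_wpM2l _ meet)); first by rewrite exprn_ge0// exprn_ge0// invr_ge0.
  have -> : (q ^+ r) ^+ 2 * (r.+1%:R * #|U|%:R * (eps * #|C|%:R) ^+ r) =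
      r.+1%:R * #|U|%:R * (eps ^+ r * q ^+ r).
    by rewrite exprMn exprVn; field; rewrite expf_neq0// gt_eqF.
  have -> : r.+1%:R ^+ 2 * eps ^+ r * q ^+ r = r.+1%:R * r.+1%:R * (eps ^+ r * q ^+ r) by ring.
  rewrite ler_wpM2r//; first by rewrite mulr_ge0// exprn_ge0// invr_ge0.
  rewrite ler_wpM2l//.
  rewrite ler_nat -[X in (_ <= X)%N](card_star r) -(card_imset _ si).
  by apply: subset_leq_card; exact: subsetDl.
have split_near :
    \sum_(t in copies K G | ~~ [disjoint span t & U] && (t != s))
      @joint R K G C s t <=
    \sum_(t in copies K G | t != s) (@joint R K G C s t - (q ^+ r) ^+ 2) +
    \sum_(t in copies K G | ~~ [disjoint span t & U]) (q ^+ r) ^+ 2.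
  rewrite [X in X <= _]big_mkcondr [X in _ <= X + _]big_mkcondr.
  rewrite [X in _ <= _ + X]big_mkcondr -big_split/=; apply: ler_sum => t tc.
  have := @joint_ge R K G C C_gt0 (ltnW K_gt1) s t si (@copies_injective K G t tc).
  rewrite card_star/=.
  have q0 : 0 <= (q ^+ r) ^+ 2 by rewrite exprn_ge0// exprn_ge0// invr_ge0.
  by case: (t != s); case: (~~ _) => /= jt; rewrite ?subrK ?addr0 ?add0r ?subr_ge0.
apply: (le_trans (lerD split_near near_count)).
by rewrite -addrA lerD2l [2 * _]mulr_natl mulr2n lerD2r.
Qed.

End star_chen.

Section many_colors.
Local Open Scope classical_set_scope.
Local Open Scope ring_scope.
Variables (R : realType) (c : nat -> nat).
Hypothesis c_cvg : c n @[n --> \oo] --> \oo.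

Lemma near_colors_ge k : \forall n \near \oo, (k <= #|'I_(c n).-1.+1|)%N.
Proof.
have /cvgnyPge/(_ k) := c_cvg; apply: filterS => n h.
by rewrite card_ord (leq_trans h)// leqSpred.
Qed.

Lemma near_inv_colors e : 0 < e ->
  \forall n \near \oo, #|'I_(c n).-1.+1|%:R^-1 <= e :> R.
Proof.
move=> e0; apply: filterS (near_colors_ge (Num.truncn e^-1).+1) => n h.
rewrite invf_ple ?posrE ?ltr0n ?card_ord//.
rewrite (le_trans (ltW (truncnS_gt _)))// ler_nat.
by move: h; rewrite card_ord.
Qed.

Lemma cvg_inv_colors : #|'I_(c n).-1.+1|%:R^-1 @[n --> \oo] --> (0 : R).
Proof.
apply: (cvg0_eps (C := 1)) => // e e0; rewrite mul1r.
apply: filterS (near_inv_colors e0) => n h.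
by rewrite ger0_norm ?invr_ge0.
Qed.

End many_colors.

Section big_stars.
Local Open Scope classical_set_scope.
Local Open Scope ring_scope.
Variables (R : realType) (lambda : R) (r : nat) (G : nat -> sgraph) (c : nat -> nat).
Hypothesis lambda_gt0 : 0 < lambda.
Hypothesis r_gt1 : (1 < r)%N.
Hypothesis c_cvg : c n @[n --> \oo] --> \oo.
Local Notation K := (star r).
Local Notation m := (count_mean R K G c).
Local Notation V := (count_variance R K G c).
Local Notation q n := (#|'I_(c n).-1.+1|%:R^-1 : R).

Lemma big_stars_poisson :
  m n @[n --> \oo] --> lambda -> V n @[n --> \oo] --> lambda ->
  forall k, pmf R K G c n k @[n --> \oo] --> poisson_pmf lambda k.
Proof.
move=> mcvg Vcvg.
pose D n : R := V n - m n + m n * q n ^+ r.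
have Dcvg : D n @[n --> \oo] --> 0.
  rewrite -[X in _ --> X](_ : lambda - lambda + lambda * 0 = 0); last first.
    by rewrite subrr mulr0 addr0.
  apply: cvgD; first exact: cvgB.
  apply: cvgM => //; apply: (@cvg0_le _ _ (fun n => q n)); last exact: cvg_inv_colors.
  near=> n; rewrite ger0_norm ?exprn_ge0 ?invr_ge0//.
  rewrite -[leRHS]expr1 ler_wiXn2l ?invr_ge0 ?(ltnW r_gt1)//.
  by rewrite invf_le1 ?ltr0n ?card_ord// ler1n.
have degree (e : R) : 0 < e -> \forall n \near \oo,
    forall v : G n, #|neighbors v|%:R <= e * #|'I_(c n).-1.+1|%:R.
  move=> e0; pose a := #|automorphisms K|; pose A : R := 4 ^+ r.+1 * a%:R ^+ 2.
  have A0 : 0 < A.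
    by rewrite mulr_gt0 ?exprn_gt0// ltr0n card_automorphisms_gt0.
  pose d0 := (8 * a + 2 * r)%N.
  have d00 : 0 < d0%:R :> R by rewrite ltr0n /d0 addn_gt0 muln_gt0 card_automorphisms_gt0.
  near=> n => v.
  have C1 : (1 < #|'I_(c n).-1.+1|)%N by near: n; exact: near_colors_ge.
  have cR : 0 < #|'I_(c n).-1.+1|%:R :> R by rewrite ltr0n ltnW.
  have [dv|dv] := leqP d0 #|neighbors v|; last first.
    have : q n <= e / d0%:R by near: n; apply: near_inv_colors => //; rewrite divr_gt0.
    rewrite ler_pdivlMr// mulrC ler_pdivrMr// => h.
    by rewrite (le_trans _ h)// ler_nat ltnW.
  have := @degree_excess R r (G n) _ C1 r_gt1 v dv.
  have K0 : (0 < #|K|)%N by rewrite card_star.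
  have := @variance_copy_count R K (G n) _ (ltnW C1) K0.
  rewrite card_star /= => <-.
  rewrite -/(m n) -/(V n) -/(D n) -/a -/A => dD.
  have AD : A * D n <= e ^+ (r + r.-1).
    have : `|D n| <= e ^+ (r + r.-1) / A.
      near: n; apply: (cvgr0_norm_le _ Dcvg); by rewrite divr_gt0// exprn_gt0.
    rewrite ler_pdivlMr// mulrC => h; rewrite (le_trans _ h)// ler_wpM2l ?ler_norm//.
    exact: ltW.
  have := le_trans dD AD.
  rewrite ler_pXn2r ?nnegrE ?divr_ge0 ?(ltW e0)//; first by rewrite ler_pdivrMr.
  by rewrite addn_gt0 ltnW.
have m1 : \forall n \near \oo, m n <= lambda + 1.
  by apply: (cvgr_le _ mcvg); rewrite ltrDl.
apply: poisson_of_chen => //.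
  by move=> n; apply/card_gt0P; exists [ffun=> ord0].
move=> e e0.
pose k : R := 2 * r.+1%:R ^+ 2 * (lambda + 1).
have k0 : 0 < k by rewrite !mulr_gt0 ?addr_gt0 ?exprn_gt0.
(* at most 1, so that powers of eps are at most eps *)
pose eps : R := Num.min 1 (e / 2 / k).
have eps0 : 0 < eps by rewrite lt_min ltr01 !divr_gt0.
near=> n => h h01.
have C0 : (0 < #|'I_(c n).-1.+1|)%N by rewrite card_ord.
have deg : forall v : G n, #|neighbors v|%:R <= eps * #|'I_(c n).-1.+1|%:R.
  by near: n; exact: degree.
apply: (le_trans (star_chen_bound C0 (ltnW r_gt1) (ltW eps0) deg h01)).
rewrite -/(m n) -/(V n) -/(D n).
have D2 : D n <= e / 2.
  rewrite (le_trans (ler_norm _))//; near: n; apply: (cvgr0_norm_le _ Dcvg).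
  by rewrite divr_gt0.
have : 2 * r.+1%:R ^+ 2 * m n * eps ^+ r <= e / 2.
  apply: (@le_trans _ _ (k * eps)).
    rewrite ler_pM ?exprn_ge0 ?(ltW eps0)//.
    - by rewrite mulr_ge0//; apply: mean_ge0.
    - by rewrite ler_wpM2l//; near: n.
    - rewrite -[leRHS]expr1 ler_wiXn2l ?(ltW eps0) ?(ltnW r_gt1)//.
      by rewrite /eps ge_min lexx.
  by rewrite mulrC -ler_pdivlMr// /eps ge_min lexx orbT.
lra.
Unshelve. all: by end_near. Qed.

End big_stars.

(** * Monochromatic edges *)

Section edges.
Variables (R : realType) (G : sgraph).
Local Notation K := (star 1).
Local Notation E := (embeddings K G).
Let o : K := (ord0 : 'I_2).
Let l : K := (ord_max : 'I_2).

Let edge_vertex (i : K) : i = o \/ i = l.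
Proof.
by case: i => -[|[|//]] ilt; [left|right]; apply/val_inj.
Qed.

Lemma sum_edges (f : G -> G -> R) :
  \sum_(s in E) f (s o) (s l) = \sum_u \sum_(v in neighbors u) f u v.
Proof.
pose h (p : G * G) : {ffun K -> G} := [ffun i => if i == o then p.1 else p.2].
pose h' (s : {ffun K -> G}) := (s o, s l).
have hh' s : h (h' s) = s.
  by apply/ffunP => i; rewrite ffunE; case: (edge_vertex i) => ->.
have h'h p : h' (h p) = p by rewrite /h' !ffunE; case: p.
rewrite (reindex_onto h h') /=; last by move=> s _; exact: hh'.
rewrite pair_big_dep/=; apply: eq_big => [p|p _]; last by rewrite !ffunE.
rewrite h'h eqxx andbT; apply/(@star_embeddings 1 G (h p))/idP => [[_ /(_ l isT)]|].
  by rewrite !ffunE inE.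
rewrite inE => pa.
split=> [i j|i io]; last first.
  by case: (edge_vertex i) io => ->; rewrite ?eqxx// !ffunE.
have p12 : p.1 != p.2 by apply/eqP => e; rewrite e adj_irrefl in pa.
case: (edge_vertex i) => ->; case: (edge_vertex j) => ->; rewrite !ffunE//=.
  by move=> /eqP; rewrite (negbTE p12).
by move=> /esym/eqP; rewrite (negbTE p12).
Qed.

Let deg (v : G) : R := #|neighbors v|%:R.

Lemma card_edges : #|E|%:R = \sum_u deg u.
Proof.
rewrite -sum1_card natr_sum (sum_edges (fun _ _ => 1)).
by apply: eq_bigr => u _; rewrite sumr_const.
Qed.

Lemma edges_at x : \sum_(s in E) (x \in span s)%:R <= 2 * deg x.
Proof.
apply: (@le_trans _ _ (\sum_(s in E) ((s o == x)%:R + (s l == x)%:R))).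
  apply: ler_sum => s _; rewrite -natrD ler_nat.
  case: (boolP (x \in _)) => // /imsetP[i _ ->].
  by case: (edge_vertex i) => ->; rewrite eqxx// addnC.
rewrite big_split/= (sum_edges (fun u _ => (u == x)%:R)) (sum_edges (fun _ v => (v == x)%:R)).
rewrite mulr_natl mulr2n lerD//.
  rewrite (bigD1 x)//= eqxx sumr_const big1 ?addr0// => u /negbTE ->.
  by rewrite big1.
rewrite (exchange_big_dep predT)//= (bigD1 x)//= [X in _ + X]big1 ?addr0; last first.
  by move=> u /negbTE ->; rewrite big1.
rewrite eqxx sumr_const /deg ler_nat subset_leq_card//.
apply/fintype.subsetP => u xu; have : x \in neighbors u := xu.
by rewrite !inE adj_sym.
Qed.

(** Only [#|E| / k] vertices have degree above [k], so an edge joining two of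
    them is rare enough for the smaller degree to be small on average. *)
Lemma sum_min_degree (k : nat) : (0 < k)%N ->
  \sum_(s in E) Num.min (deg (s o)) (deg (s l)) <=
  #|E|%:R * (k%:R + #|E|%:R / k%:R).
Proof.
move=> k0; have kR : 0 < k%:R :> R by rewrite ltr0n.
rewrite (sum_edges (fun u v => Num.min (deg u) (deg v))).
pose heavy : {set G} := [set v | k%:R < deg v].
have heavy_le : #|heavy|%:R <= #|E|%:R / k%:R :> R.
  rewrite ler_pdivlMr// card_edges -sum1_card natr_sum mulr_suml big_mkcond/= ler_sum//.
  by move=> u _; rewrite inE; case: ltrP => // /ltW; rewrite mul1r.
apply: (@le_trans _ _ (\sum_u \sum_(v in neighbors u) (k%:R + deg u * (v \in heavy)%:R))).
  apply: ler_sum => u _; apply: ler_sum => v _.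
  rewrite ge_min inE; case: (lerP (deg v) k%:R) => vk /=.
    by rewrite mulr0 addr0 vk orbT.
  by rewrite mulr1 lerDr ltW.
have -> : #|E|%:R * (k%:R + #|E|%:R / k%:R) =
    \sum_u (deg u * k%:R + deg u * (#|E|%:R / k%:R)).
  by rewrite big_split/= -!mulr_suml -card_edges mulrDr.
apply: ler_sum => u _; rewrite big_split/= sumr_const -[k%:R *+ _]mulr_natl lerD2l.
rewrite -mulr_sumr ler_wpM2l// (le_trans _ heavy_le)// -natr_sum ler_nat.
rewrite -sum1_card big_mkcond [leqRHS]big_mkcond/= leq_sum// => v _.
by case: (v \in neighbors u); case: (v \in heavy).
Qed.

Lemma edge_same_copy (s t : {ffun K -> G}) : s \in E -> t \in E ->
  span t \subset span s -> same_copy s t.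
Proof.
move=> /embeddingsP[si _] /embeddingsP[ti _] /fintype.subsetP ts.
have tol : t o != t l by rewrite (inj_eq ti).
have val i : t i = s o \/ t i = s l.
  have /imsetP[j _ ->] := ts _ (mem_span t i).
  by case: (edge_vertex j) => ->; [left|right].
pose swap : {perm K} := tperm o l.
have swapA : swap \in automorphisms K.
  apply/automorphismsP => a b.
  by case: (edge_vertex a) => ->; case: (edge_vertex b) => ->; rewrite ?tpermL ?tpermR.
apply/same_copyP; case: (val o) => to; case: (val l) => tl.
- by rewrite to tl eqxx in tol.
- exists 1%g; first exact: automorphisms1.
  by rewrite precomp1; apply/ffunP => i; case: (edge_vertex i) => ->.
- exists swap => //.
  by apply/ffunP => i; rewrite ffunE; case: (edge_vertex i) => ->; rewrite ?tpermL ?tpermR.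
- by rewrite to tl eqxx in tol.
Qed.

Variable C : finType.
Hypothesis C_gt0 : (0 < #|C|)%N.
Local Notation Om := {ffun G -> C}.
Local Notation T := (fun X : Om => copy_count K X).
Local Notation q := (#|C|%:R^-1 : R).
Local Notation m := (mean (fun X : Om => (T X)%:R : R)).

(** Edges through a vertex of degree of order [#|C|] are not rare, so the pivot of
    an edge is its endpoint of larger degree and only edges through the other
    endpoint contribute to the error. *)
Lemma edge_chen_bound (h : nat -> R) (k : nat) (a := #|automorphisms K|) :
  (forall k, 0 <= h k <= 1) -> (0 < k)%N ->
  `|mean (fun X => (T X)%:R * h (T X)) - m * mean (fun X => h (T X).+1)| <=
  4 * (a%:R * m) * (k%:R * q + a%:R * m / k%:R).
Proof.
move=> h01 k0.
have c0 : 0 < #|C|%:R :> R by rewrite ltr0n.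
have q0 : 0 <= q by rewrite invr_ge0.
have q1 : q <= 1 by rewrite invf_le1// ler1n.
have K2 : #|K| = 2 by rewrite card_star.
have K_gt1 : (1 < #|K|)%N by rewrite K2.
have inj (s : {ffun K -> G}) : s \in copies K G -> injective (fun a => s a).
  exact: copies_injective.
pose pivot (s : {ffun K -> G}) : K := if deg (s o) <= deg (s l) then l else o.
pose low (s : {ffun K -> G}) : G := if deg (s o) <= deg (s l) then s o else s l.
have := @family_chen R G C K _ (copies K G) (fun s a => s a) pivot C_gt0 K_gt1 inj h h01.
move=> /le_trans; apply; rewrite K2/= expr1.
have touchE (s t : {ffun K -> G}) : s \in copies K G ->
    touches (fun (s : {ffun K -> G}) (a : K) => s a) pivot s t = (low s \in span t).
  move=> sc; have si := @copies_injective K G s sc.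
  rewrite /touches; suff -> : span s :\ s (pivot s) = [set low s].
    by rewrite disjoint_sym disjoints1 negbK.
  apply/setP => x.
  rewrite !inE /pivot /low; case: ifP => _.
    apply/andP/eqP => [[xl /imsetP[i _ xi]]|->].
      by move: xl; rewrite xi; case: (edge_vertex i) => ->; rewrite ?eqxx.
    by rewrite (inj_eq si) mem_span.
  apply/andP/eqP => [[xl /imsetP[i _ xi]]|->].
    by move: xl; rewrite xi; case: (edge_vertex i) => ->; rewrite ?eqxx.
  by rewrite (inj_eq si) mem_span.
have emb_card : #|E|%:R * q = a%:R * m.
  rewrite mean_copy_count// ?(ltnW K_gt1)// K2 expr1 mulrA; congr (_ * _).
  have := @sum_embeddings K G R (fun=> 1) (fun _ _ _ => erefl).
  by rewrite !sumr_const.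
apply: (@le_trans _ _ (\sum_(s in copies K G) 4 * q ^+ 2 * deg (low s))).
  apply: ler_sum => s sc.
  have at_low : \sum_(t in copies K G |
        touches (fun (s : {ffun K -> G}) (a : K) => s a) pivot s t) q ^+ 2 <=
      2 * q ^+ 2 * deg (low s).
    rewrite [2 * _]mulrC -mulrA.
    apply: (le_trans _ (ler_wpM2l _ (edges_at (low s)))); last first.
      by rewrite exprn_ge0.
    rewrite mulr_sumr [leLHS]big_mkcond [leRHS]big_mkcond/= ler_sum// => t _.
    case: ifP => [/andP[tc]|_]; last by case: ifP => // _; rewrite mulr_ge0// exprn_ge0.
    by rewrite touchE// => ->; rewrite (@copies_embeddings K G t tc) mulr1.
  have -> : 4 * q ^+ 2 * deg (low s) =
      2 * q ^+ 2 * deg (low s) + 2 * q ^+ 2 * deg (low s) by ring.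
  rewrite lerD// (le_trans _ at_low)//.
  rewrite [leLHS]big_mkcond [leRHS]big_mkcond/= ler_sum// => t _.
  case: ifP => [/andP[tc /andP[st ts]]|_]; last by case: ifP => // _; rewrite exprn_ge0.
  rewrite tc st/=; move: st; rewrite touchE// => st.
  have ss : low s \in span s by rewrite /low; case: ifP => _; exact: mem_span.
  have /imsetP[i _ si'] := ss; have /imsetP[j _ tj] := st.
  have si := @copies_injective K G s sc.
  rewrite (mean_monochromaticI R C_gt0 (a := i) (b := j) si) -?si'//.
  rewrite K2 expr1 expr2 ler_wpM2l// -[leRHS]expr1 ler_wiXn2l//.
  rewrite card_gt0; apply/negP; rewrite finset.setD_eq0 => sub.
  have := edge_same_copy (@copies_embeddings K G s sc) (@copies_embeddings K G t tc) sub.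
  by move=> /(@copies_eq K G s t sc tc) e; rewrite e eqxx in ts.
rewrite -mulr_sumr.
apply: (@le_trans _ _ (4 * q ^+ 2 * (#|E|%:R * (k%:R + #|E|%:R / k%:R)))).
  rewrite ler_wpM2l ?mulr_ge0 ?exprn_ge0//.
  apply: le_trans (sum_min_degree k0).
  rewrite [leLHS]big_mkcond [leRHS]big_mkcond/= ler_sum// => s _.
  case: ifP => [/(@copies_embeddings K G) ->|_].
    by rewrite le_min /low; case: ifP => [->|/negbT]; rewrite ?lexx// -ltNge => /ltW ->.
  by case: ifP => // _; rewrite le_min /deg !ler0n.
by rewrite -emb_card; apply: eq_ler; ring.
Qed.

End edges.

Section edges_poisson.
Variables (R : realType) (lambda : R) (G : nat -> sgraph) (c : nat -> nat).
Hypothesis lambda_gt0 : 0 < lambda.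
Hypothesis c_cvg : (c n @[n --> \oo] --> \oo)%classic.
Local Notation K := (star 1).
Local Notation m := (count_mean R K G c).

Lemma edges_poisson : (m n @[n --> \oo] --> lambda)%classic ->
  forall k, (pmf R K G c n k @[n --> \oo] --> poisson_pmf lambda k)%classic.
Proof.
move=> mcvg.
have m1 : \forall n \near \oo%classic, m n <= lambda + 1.
  by apply: (cvgr_le _ mcvg); rewrite ltrDl.
apply: poisson_of_chen => //.
  by move=> n; apply/card_gt0P; exists [ffun=> ord0].
move=> e e0; pose a := #|automorphisms K|.
have a0 : 0 < a%:R :> R by rewrite ltr0n card_automorphisms_gt0.
pose L := a%:R * (lambda + 1).
have L0 : 0 < L by rewrite mulr_gt0// addr_gt0.
pose k := (Num.truncn (8 * L ^+ 2 / e)).+1.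
have kR : 0 < k%:R :> R by rewrite ltr0n.
near=> n => h h01.
have C0 : (0 < #|'I_(c n).-1.+1|)%N by rewrite card_ord.
apply: (le_trans (@edge_chen_bound R (G n) _ C0 h k h01 isT)).
rewrite -/(m n) -/a.
have m0 : 0 <= m n by apply: mean_ge0.
have mL : a%:R * m n <= L by rewrite ler_wpM2l ?(ltW a0)//; near: n.
have am0 : 0 <= a%:R * m n by rewrite mulr_ge0.
apply: (@le_trans _ _ (4 * L * (e / (8 * L) + e / (8 * L)))); last first.
  by apply: eq_ler; field; rewrite gt_eqF.
apply: ler_pM => //.
- by rewrite mulr_ge0.
- by rewrite addr_ge0// ?divr_ge0// mulr_ge0// invr_ge0.
- by rewrite ler_wpM2l.
apply: lerD.
  rewrite mulrC -ler_pdivlMr//; near: n; apply: near_inv_colors => //.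
  by rewrite !divr_gt0// mulr_gt0.
apply: (@le_trans _ _ (L / k%:R)); first by rewrite ler_wpM2r// invr_ge0.
have L8 : 0 < 8 * L by rewrite mulr_gt0.
rewrite ler_pdivrMr// mulrAC ler_pdivlMr//.
have := truncnS_gt (8 * L ^+ 2 / e); rewrite -/k ltr_pdivrMr// => /ltW kh.
by rewrite [leRHS]mulrC (_ : L * (8 * L) = 8 * L ^+ 2)//; ring.
Unshelve. all: by end_near. Qed.

End edges_poisson.

(** * A Poisson limit with diverging mean *)

Section connected.
Variable H : sgraph.
Hypothesis H_connected : connected_graph H.

Lemma connected_constant (D : Type) (f : H -> D) :
  (forall a b, adj a b -> f a = f b) -> forall a b, f a = f b.
Proof.
move=> fadj a b; have /connectP[p ap ->] := H_connected a b.
elim: p a ap => [//|x p IH] a /= /andP[ax xp].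
by rewrite (fadj _ _ ax) (IH _ xp).
Qed.

Lemma connected_neighbor (x z : H) : x != z -> exists y, adj x y.
Proof.
move=> xz; case: (pickP (adj x)) => [y xy|none]; first by exists y.
have eqx a b : adj a b -> (a == x) = (b == x).
  move=> ab; case: eqVneq ab => [->|ax]; first by rewrite none.
  by case: eqVneq => [->|//]; rewrite adj_sym none.
by have := connected_constant eqx x z; rewrite eqxx eq_sym (negbTE xz).
Qed.

(** By connectedness every vertex other than [z] has a neighbor, which can only be
    [z]. *)
Lemma star_of_cover (z : H) : (1 < #|H|)%N ->
  (forall a b, adj a b -> (a == z) || (b == z)) -> is_star H.
Proof.
move=> H_gt1 cover.
have adjz x : x != z -> adj x z.
  move=> xz; have [y xy] := connected_neighbor xz.
  by have := cover _ _ xy; rewrite (negbTE xz)/= => /eqP <-.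
have adjE a b : adj a b = ((a == z) != (b == z)).
  case: (eqVneq a z) => [->|az]; case: (eqVneq b z) => [->|bz] /=.
  - by rewrite adj_irrefl.
  - by rewrite adj_sym adjz.
  - by rewrite adjz.
  - by apply/negP => /cover; rewrite (negbTE az) (negbTE bz).
have H0 : (#|H|.-1.+1 = #|H|)%N by rewrite prednK// ltnW.
exists #|H|.-1; first by rewrite -ltnS H0.
pose f (x : H) : 'I_#|H|.-1.+1 :=
  tperm (cast_ord (esym H0) (enum_rank z)) ord0 (cast_ord (esym H0) (enum_rank x)).
have f_inj : injective f by move=> x y /perm_inj/cast_ord_inj/enum_rank_inj.
have fz : f z = ord0 by rewrite /f tpermL.
have f0 x : (f x == ord0) = (x == z) by rewrite -fz (inj_eq f_inj).
exists f; last by move=> x y; rewrite /= /star_adj !f0 adjE.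
apply: inj_card_bij => //; by rewrite card_ord H0.
Qed.

(** Injective edge-preserving self-maps of a finite graph are automorphisms,
    as they permute the finite set of arcs. *)
Lemma endo_automorphism (g : {perm H}) :
  (forall a b, adj a b -> adj (g a) (g b)) -> g \in automorphisms H.
Proof.
move=> gadj; apply/automorphismsP => a b; apply/idP/idP; last exact: gadj.
pose A : {set H * H} := [set p | adj p.1 p.2].
pose g2 (p : H * H) := (g p.1, g p.2).
have g2_inj : injective g2 by move=> [x y] [x' y'] [/perm_inj -> /perm_inj ->].
have gA : g2 @: A = A.
  apply/eqP; rewrite eqEcard card_imset// leqnn andbT.
  by apply/fintype.subsetP => _ /imsetP[p pA ->]; move: pA; rewrite !inE; exact: gadj.
move=> gab; have : (g a, g b) \in g2 @: A by rewrite gA inE.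
by move=> /imsetP[[x y]]; rewrite inE/= => xy [/perm_inj -> /perm_inj ->].
Qed.

End connected.

Section construction.
Variables (H : sgraph) (m M : nat).

(** Disjoint copies of [H], which carry the Poisson limit, together with a clique
    on the vertices of [H] joined to many independent vertices. *)
Definition gadget_vertex : finType := (('I_m * H) + (H + 'I_M))%type.

Definition gadget_adj : rel gadget_vertex := fun u v =>
  match u, v with
  | inl (i, x), inl (j, y) => (i == j) && adj x y
  | inr (inl x), inr (inl y) => x != y
  | inr (inl _), inr (inr _) | inr (inr _), inr (inl _) => true
  | _, _ => false
  end.

Lemma gadget_sym : symmetric gadget_adj.
Proof.
move=> [[i x]|[x|i]] [[j y]|[y|j]] //=; first by rewrite eq_sym adj_sym.
by rewrite eq_sym.
Qed.

Lemma gadget_irrefl : irreflexive gadget_adj.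
Proof. by move=> [[i x]|[x|i]] //=; rewrite ?adj_irrefl ?andbF ?eqxx. Qed.

Definition gadget : sgraph := SGraph gadget_sym gadget_irrefl.

Hypothesis H_connected : connected_graph H.
Hypothesis H_gt1 : (1 < #|H|)%N.
Hypothesis H_not_star : ~ is_star H.

Definition part (u : gadget) : option 'I_m :=
  if u is inl (i, _) then Some i else None.

Lemma part_adj u v : adj u v -> part u = part v.
Proof. by case: u v => [[i x]|[x|i]] [[j y]|[y|j]] //= /andP[/eqP ->]. Qed.

Definition core (x : H) : gadget := inr (inl x).

Definition block (i : 'I_m) : {ffun H -> gadget} := [ffun x => inl (i, x)].

Lemma block_inj i : injective (block i).
Proof. by move=> x y; rewrite !ffunE => -[]. Qed.

Lemma block_embedding i : block i \in embeddings H gadget.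
Proof.
apply/embeddingsP; split; first exact: block_inj.
by move=> a b ab; rewrite !ffunE /= eqxx.
Qed.

Lemma mem_block i u : (u \in span (block i)) = (part u == Some i).
Proof.
apply/imsetP/eqP => [[x _ ->]|]; first by rewrite ffunE.
by case: u => [[j x]|//] /= [->]; exists x => //; rewrite ffunE.
Qed.

Lemma embedding_part s : s \in embeddings H gadget ->
  forall a b, part (s a) = part (s b).
Proof.
move=> /embeddingsP[_ h]; apply: connected_constant => // a b ab.
by apply: part_adj; exact: h.
Qed.

Lemma embedding_block s i a : s \in embeddings H gadget ->
  part (s a) = Some i -> same_copy (block i) s.
Proof.
move=> sE sa; have [si sh] := embeddingsP _ sE.
pose g x := if s x is inl (_, y) then y else x.
have sx x : s x = inl (i, g x).
  have := embedding_part sE x a; rewrite sa /g.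
  by case: (s x) => [[j y]|//] /= [->].
have g_inj : injective g.
  by move=> x y gxy; apply: si; rewrite !sx gxy.
apply/same_copyP; exists (perm g_inj).
  apply: endo_automorphism => x y xy; rewrite !permE.
  by have := sh _ _ xy; rewrite !sx /= eqxx.
by apply/ffunP => x; rewrite !ffunE permE sx.
Qed.

(** Outside the blocks a copy of [H] is confined to the clique and the
    independent vertices; its clique vertices cover its edges, so there are at
    least two of them unless [H] is a star. *)
Lemma embedding_core (C : finType) (X : {ffun gadget -> C}) s a :
  s \in embeddings H gadget -> part (s a) = None -> monochromatic s X ->
  exists p : H * H, (p.1 != p.2) && (X (core p.1) == X (core p.2)).
Proof.
move=> sE sa sX; have [si sh] := embeddingsP _ sE.
pose in_core b := if s b is inr (inl _) then true else false.
have coreE b : in_core b -> exists x, s b = core x.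
  by rewrite /in_core /core; case: (s b) => [//|[x|//]] _; exists x.
have cover b d : adj b d -> in_core b || in_core d.
  move=> /sh; have := embedding_part sE b a; have := embedding_part sE d a.
  by rewrite sa /in_core; case: (s b) => [[]//|[x|i]]; case: (s d) => [[]//|[y|j]].
have [z zc] : exists z, in_core z.
  have [b ba] : exists b, b != a.
    have : (0 < #|predC1 a|)%N by rewrite cardC1 -ltnS prednK// ltnW.
    by move=> /card_gt0P[b]; exists b.
  have [d bd] := connected_neighbor H_connected ba.
  by have /orP[] := cover _ _ bd; [exists b|exists d].
case: (pickP [pred b | in_core b && (b != z)]) => [b /andP[bc bz]|only].
  have [x sx] := coreE _ bc; have [y sy] := coreE _ zc.
  exists (x, y) => /=; rewrite -sx -sy; apply/andP; split.
    by apply: contraNneq bz => xy; apply/eqP/si; rewrite sx sy xy.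
  by apply/eqP; move/monochromaticP : sX; apply.
exfalso; apply: H_not_star; apply: (star_of_cover H_connected (z := z) H_gt1) => b d.
move=> /cover bd; have := only b; have := only d; rewrite /=.
by case/orP : bd => ->; case: (b == z); case: (d == z).
Qed.

Definition block_count (C : finType) (X : {ffun gadget -> C}) : nat :=
  \sum_(i : 'I_m) monochromatic (block i) X.

Definition core_clash (C : finType) (X : {ffun gadget -> C}) : bool :=
  [exists p : H * H, (p.1 != p.2) && (X (core p.1) == X (core p.2))].

Lemma gadget_count (C : finType) (X : {ffun gadget -> C}) :
  ~~ core_clash X -> copy_count H X = block_count X.
Proof.
move=> no_clash; rewrite /copy_count /block_count.
have [a _] : exists a : H, true by have /card_gt0P[a _] := ltnW H_gt1; exists a.
pose B := [set representative (block i) | i : 'I_m].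
have Binj : injective (fun i => representative (block i)).
  move=> i j ij; have : same_copy (block i) (block j).
    apply: same_copy_trans (representative_same _) _.
    by rewrite ij same_copy_sym representative_same.
  move=> /same_copyP[g _ e]; have := mem_block i (block j a).
  rewrite -(span_precomp (block i) g) -e mem_span ffunE /=.
  by move=> /esym/eqP[].
rewrite (bigID (mem B))/= [X in (_ + X)%N]big1 ?addn0; last first.
  move=> s /andP[sc sB]; apply/eqP; rewrite eqb0; apply/negP => sX.
  have sE := @copies_embeddings H gadget s sc.
  case e : (part (s a)) => [i|]; last first.
    have [p pP] := embedding_core sE e sX.
    by case/negP : no_clash; apply/existsP; exists p.
  have bs := embedding_block sE e.
  case/negP : sB; apply/imsetP; exists i => //.
  by rewrite (representative_eq bs); move: sc; rewrite inE => /andP[_ /eqP].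
rewrite (eq_bigl (mem B)); last first.
  move=> s /=; case sB : (s \in B); rewrite ?andbF// andbT.
  by have /imsetP[i _ ->] := sB; exact: representative_copies (block_embedding i).
rewrite big_imset/=; last by move=> i j _ _; exact: Binj.
apply: eq_bigr => i _.
have /same_copyP[g _ e] := representative_same (block i).
congr nat_of_bool; apply: etrans (monochromatic_precomp (block i) g X).
by rewrite e.
Qed.

Lemma card_gadget_embeddings : (M <= #|embeddings H gadget|)%N.
Proof.
have [h0 _] : exists a : H, true by have /card_gt0P[a _] := ltnW H_gt1; exists a.
pose s (j : 'I_M) : {ffun H -> gadget} :=
  [ffun x => if x == h0 then inr (inr j) else core x].
have s_inj : injective s.
  by move=> i j /ffunP/(_ h0); rewrite !ffunE eqxx => -[].
rewrite -[X in (X <= _)%N]card_ord -(card_imset _ s_inj) subset_leq_card//.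
apply/fintype.subsetP => _ /imsetP[j _ ->]; apply/embeddingsP; split.
  move=> x y; rewrite !ffunE.
  by have [->|_] := eqVneq x h0; have [->|_] := eqVneq y h0 => // -[].
move=> x y xy; have xy' : x != y by apply/eqP => e; rewrite e adj_irrefl in xy.
rewrite !ffunE; have [xh|_] := eqVneq x h0; have [yh|_] := eqVneq y h0 => //.
by rewrite xh yh eqxx in xy'.
Qed.

End construction.

Section gadget_law.
Local Open Scope classical_set_scope.
Local Open Scope ring_scope.
Variables (R : realType) (H : sgraph) (m M : nat) (C : finType).
Hypothesis H_connected : connected_graph H.
Hypothesis H_gt1 : (1 < #|H|)%N.
Hypothesis H_not_star : ~ is_star H.
Hypothesis C_gt0 : (0 < #|C|)%N.
Local Notation G := (gadget H m M).
Local Notation Om := {ffun G -> C}.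
Local Notation q := (#|C|%:R^-1 : R).
Local Notation p := (q ^+ #|H|.-1).

Lemma prob_core_clash :
  mean (fun X : Om => (core_clash X)%:R : R) <= #|H|%:R ^+ 2 * q.
Proof.
apply: (@le_trans _ _ (\sum_(e : H * H | e.1 != e.2)
    mean (fun X : Om => (X (core m M e.1) == X (core m M e.2))%:R))).
  rewrite -mean_sum; apply: le_mean => X; rewrite -natr_sum ler_nat.
  have [/existsP[e /andP[e12 eX]]|//] := boolP (core_clash X).
  by rewrite (bigD1 e)//= eX.
rewrite (eq_bigr (fun=> q)); last first.
  move=> e e12; have /card_gt0P[k _] := C_gt0.
  have := @mean_match1 R G C finset.set0 (fun=> 1) (core m M e.1) (core m M e.2).
  rewrite (mean_cst [ffun=> k]) mul1r => <-//; last 2 first.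
  - by rewrite inE.
  - by apply: contraNneq e12 => -[->].
  by apply: eq_mean => X; rewrite mul1r.
rewrite sumr_const -[_ *+ _]mulr_natl ler_wpM2r ?invr_ge0//.
by rewrite -natrX ler_nat (leq_trans (max_card _))// card_prod -mulnn.
Qed.

Lemma mean_block_count : mean (fun X : Om => (block_count X)%:R : R) = m%:R * p.
Proof.
under eq_mean do rewrite /block_count natr_sum.
rewrite mean_sum (eq_bigr (fun=> p)); first by rewrite sumr_const card_ord mulr_natl.
by move=> i _; rewrite mean_monochromatic ?(ltnW H_gt1)//; exact: block_inj.
Qed.

Lemma block_chen (h : nat -> R) : (forall k, 0 <= h k <= 1) ->
  `|mean (fun X : Om => (block_count X)%:R * h (block_count X)) -
    mean (fun X : Om => (block_count X)%:R) *
    mean (fun X : Om => h (block_count X).+1)| <= m%:R * p * p.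
Proof.
move=> h01.
have [a _] : exists a : H, true by have /card_gt0P[a _] := ltnW H_gt1; exists a.
have inj (i : 'I_m) : i \in [set: 'I_m]%SET -> injective (@block H m M i : H -> G).
  by move=> _; exact: block_inj.
have := @family_chen R G C H 'I_m [set: 'I_m]%SET (fun i => @block H m M i) (fun=> a)
  C_gt0 H_gt1 inj h h01.
have cnt (X : Om) : family_count [set: 'I_m]%SET (fun i => @block H m M i) X = block_count X.
  by apply: eq_bigl => i; rewrite inE.
under eq_mean do rewrite cnt.
under [X in _ - X * _]eq_mean do rewrite cnt.
under [X in _ - _ * X]eq_mean do rewrite cnt.
move/le_trans; apply.
have far i j : touches (fun i : 'I_m => @block H m M i : H -> G) (fun=> a) i j -> j = i.
  rewrite /touches -setI_eq0 => /set0Pn[u]; rewrite !inE => /and3P[uj _ ui].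
  by move: uj ui; rewrite !mem_block => /eqP -> /eqP[].
have -> : m%:R * p * p = \sum_(i : 'I_m) p ^+ 2.
  by rewrite sumr_const card_ord -[RHS]mulr_natl expr2 mulrA.
rewrite big_mkcond/=; apply: ler_sum => i _; case: ifP => [_|_]; last first.
  by rewrite exprn_ge0// exprn_ge0// invr_ge0.
rewrite big1 ?add0r; last first.
  by move=> j /and3P[_ /far ->]; rewrite eqxx.
rewrite big_mkcond (bigD1 i)//= big1 ?addr0; last first.
  by move=> j ji; case: ifP => // /andP[_ /far e]; rewrite e eqxx in ji.
by case: ifP => // _; rewrite exprn_ge0// exprn_ge0// invr_ge0.
Qed.

Lemma mean_gadget_ge :
  M%:R * p / #|automorphisms H|%:R <= mean (fun X : Om => (copy_count H X)%:R : R).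
Proof.
have a0 : 0 < #|automorphisms H|%:R :> R by rewrite ltr0n card_automorphisms_gt0.
rewrite mean_copy_count ?(ltnW H_gt1)// ler_pdivrMr// mulrAC ler_wpM2r//.
have := @sum_embeddings H G R (fun=> 1) (fun _ _ _ => erefl).
rewrite !sumr_const mulrC => <-.
by rewrite ler_nat card_gadget_embeddings.
Qed.

End gadget_law.

Section counterexample.
Local Open Scope classical_set_scope.
Local Open Scope ring_scope.
Variables (R : realType) (lambda : R) (H : sgraph).
Hypothesis lambda_gt0 : 0 < lambda.
Hypothesis H_connected : connected_graph H.
Hypothesis H_gt1 : (1 < #|H|)%N.
Hypothesis H_not_star : ~ is_star H.

Let c (n : nat) := n.+1.
(* the expected number of monochromatic blocks tends to [lambda] *)
Let blocks (n : nat) := Num.truncn (lambda * (c n)%:R ^+ #|H|.-1).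
(* each independent vertex yields a copy of [H] with probability [c n ^- (#|H| - 1)],
   so this many make the mean at least of order [c n] *)
Let twins (n : nat) := (c n ^ #|H|)%N.

Definition gadget_seq (n : nat) : sgraph := gadget H (blocks n) (twins n).

Lemma succn_cvg : c n @[n --> \oo] --> \oo.
Proof. by apply/cvgnyPge => k; near=> n; rewrite /c ltnW// ltnS; near: n; exact: nbhs_infty_ge.
Unshelve. all: by end_near. Qed.

Let q n : R := #|'I_(c n).-1.+1|%:R^-1.
Let qE n : q n = n.+1%:R^-1. Proof. by rewrite /q card_ord. Qed.

Lemma card_gadget_seq_cvg : #|gadget_seq n| @[n --> \oo] --> \oo.
Proof.
apply/cvgnyPge => k; near=> n.
apply: (@leq_trans (c n)); first by rewrite /c ltnW// ltnS; near: n; exact: nbhs_infty_ge.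
rewrite /= !card_sum card_ord addnA; apply: leq_trans (leq_addl _ _).
by rewrite /twins -[X in (X <= _)%N]expn1 leq_pexp2l// ltnW.
Unshelve. all: by end_near. Qed.

Let p_cvg : q n ^+ #|H|.-1 @[n --> \oo] --> 0.
Proof.
apply: (@cvg0_le _ _ q); last exact: (cvg_inv_colors succn_cvg).
near=> n; rewrite qE ger0_norm ?exprn_ge0 ?invr_ge0// -[leRHS]expr1 ler_wiXn2l ?invr_ge0//.
  by rewrite invf_le1// ler1n.
by rewrite -ltnS prednK// ltnW.
Unshelve. all: by end_near. Qed.

Let mean_cvg : (blocks n)%:R * q n ^+ #|H|.-1 @[n --> \oo] --> lambda.
Proof.
apply: (@squeeze_cvgr _ _ _ _ (fun n => lambda - q n ^+ #|H|.-1) (fun=> lambda)).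
- near=> n; rewrite qE exprVn.
  have c0 : 0 < n.+1%:R ^+ #|H|.-1 :> R by rewrite exprn_gt0.
  rewrite ler_pdivrMr// ler_pdivlMr// mulrBl mulVf ?gt_eqF//.
  have := @Num.Theory.truncn_itv R (lambda * n.+1%:R ^+ #|H|.-1).
  rewrite mulr_ge0 ?(ltW lambda_gt0) ?(ltW c0)// => /(_ isT)/andP[h1 h2].
  by rewrite h1 andbT lerBlDr natr1 ltW.
- rewrite -[X in _ --> X]subr0; apply: cvgB => //; exact: cvg_cst.
- exact: cvg_cst.
Unshelve. all: by end_near. Qed.

Lemma gadget_seq_poisson k :
  pmf R H gadget_seq c n k @[n --> \oo] --> poisson_pmf lambda k.
Proof.
pose bpmf n : R := mean (fun X : coloring_seq gadget_seq c n =>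
  (block_count (X : {ffun gadget H (blocks n) (twins n) -> 'I_(c n).-1.+1}) == k)%:R).
have bcvg : bpmf n @[n --> \oo] --> poisson_pmf lambda k.
  move: k @bpmf; apply: (@poisson_of_chen R lambda lambda_gt0 (coloring_seq gadget_seq c)
    (fun n X => block_count (X : {ffun gadget H (blocks n) (twins n) -> 'I_(c n).-1.+1}))).
  - by move=> n; apply/card_gt0P; exists [ffun=> ord0].
  - under eq_fun do rewrite mean_block_count ?card_ord//.
    by under eq_fun do rewrite -qE.
  - move=> e e0.
    have err : (blocks n)%:R * q n ^+ #|H|.-1 * q n ^+ #|H|.-1 @[n --> \oo] --> 0.
      by rewrite -[X in _ --> X](mulr0 lambda); exact: cvgM.
    near=> n => h h01.
    have C0 : (0 < #|'I_(c n).-1.+1|)%N by rewrite card_ord.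
    have := @block_chen R H (blocks n) (twins n) _ H_gt1 C0 h h01.
    rewrite -/(q n) => /le_trans; apply; apply: le_trans (ler_norm _) _.
    by near: n; exact: (cvgr0_norm_le _ err).
have diff : pmf R H gadget_seq c n k - bpmf n @[n --> \oo] --> 0.
  apply: (@cvg0_le _ _ (fun n => #|H|%:R ^+ 2 * q n)).
    near=> n; rewrite /pmf /bpmf -meanB (le_trans (norm_mean _))//.
    apply: le_trans (prob_core_clash R H (blocks n) (twins n) _); rewrite ?card_ord//.
    apply: le_mean => X.
    have [clash|ok] := boolP (core_clash
        (X : {ffun gadget H (blocks n) (twins n) -> 'I_(c n).-1.+1})).
      by case: (_ == k); case: (_ == k); rewrite ?subrr ?subr0 ?sub0r ?normrN ?normr0 ?normr1.
    by rewrite (gadget_count H_connected H_gt1 H_not_star ok) subrr normr0.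
  rewrite -[X in _ --> X](mulr0 (#|H|%:R ^+ 2)); apply: cvgM; first exact: cvg_cst.
  exact: (cvg_inv_colors succn_cvg).
have -> : (fun n => pmf R H gadget_seq c n k) =
    (fun n => (pmf R H gadget_seq c n k - bpmf n) + bpmf n).
  by apply/funext => n; rewrite subrK.
by rewrite -[X in _ --> X]add0r; exact: cvgD.
Unshelve. all: by end_near. Qed.

Lemma gadget_seq_mean : ~ (count_mean R H gadget_seq c n @[n --> \oo] --> lambda).
Proof.
move=> mcvg.
have a0 : 0 < #|automorphisms H|%:R :> R by rewrite ltr0n card_automorphisms_gt0.
pose N := Num.truncn ((lambda + 1) * #|automorphisms H|%:R).
have [n [Nn nl]] : exists n, (N <= n)%N /\ count_mean R H gadget_seq c n <= lambda + 1.
  have [n0 _ hn] : \forall n \near \oo, (N <= n)%N /\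
      count_mean R H gadget_seq c n <= lambda + 1.
    near=> n; split; first by near: n; exact: nbhs_infty_ge.
    by near: n; apply: (cvgr_le _ mcvg); rewrite ltrDl.
  by exists n0; exact: (hn n0 (leqnn _)).
have := @mean_gadget_ge R H (blocks n) (twins n) 'I_(c n).-1.+1 H_gt1.
rewrite card_ord => /(_ isT) => h.
have {h} := le_trans h nl.
rewrite ler_pdivrMr// leNgt => /negP; apply.
have -> : (twins n)%:R * ((c n).-1.+1%:R^-1 : R) ^+ #|H|.-1 = n.+1%:R.
  rewrite /twins /c /= natrX -{1}(prednK (ltnW H_gt1)) exprS exprVn mulfK//.
by rewrite (lt_le_trans (Num.Theory.truncnS_gt _))// ler_nat ltnS.
Unshelve. all: by end_near. Qed.

End counterexample.

(** * The equivalence for stars and its failure for other graphs *)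

Local Open Scope classical_set_scope.
Local Open Scope ring_scope.

Section moments.
Variables (R : realType) (H : sgraph) (G : nat -> sgraph) (c : nat -> nat).

Lemma cvg_EFinP (f : nat -> R) (l : R) :
  ((f n)%:E @[n --> \oo] --> l%:E)%E <-> f n @[n --> \oo] --> l.
Proof.
split; first by move/fine_cvg.
by move=> fl; apply: cvg_EFin => //; near=> n.
Unshelve. all: by end_near. Qed.

Lemma cvg_expectationP l :
  ('E_(uniform_coloring R (G n) (c n))[mono_copies_rv R H (G n) (c n)]
     @[n --> \oo] --> l%:E)%E <->
  count_mean R H G c n @[n --> \oo] --> l.
Proof. by under eq_fun do rewrite expectation_mono_copies; exact: cvg_EFinP. Qed.

Lemma cvg_varianceP l :
  ('V_(uniform_coloring R (G n) (c n))[mono_copies_rv R H (G n) (c n)]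
     @[n --> \oo] --> l%:E)%E <->
  count_variance R H G c n @[n --> \oo] --> l.
Proof. by under eq_fun do rewrite variance_mono_copies; exact: cvg_EFinP. Qed.

End moments.

Theorem theorem1p2 (R : realType) (lambda : R) (lambda_gt0 : 0 < lambda) :
  (forall (r : nat) (G : nat -> sgraph) (c : nat -> nat),
      (1 <= r)%N ->
      #|G n| @[n --> \oo] --> \oo ->
      (forall n, (0 < c n)%N) ->
      c n @[n --> \oo] --> \oo ->
      (cvg_in_distribution
         (fun n => mono_copies_rv R (star r) (G n) (c n)) (poisson_rv lambda)
       <->
       ('E_(uniform_coloring R (G n) (c n))[mono_copies_rv R (star r) (G n) (c n)]
          @[n --> \oo] --> lambda%:E)%E /\
       ('V_(uniform_coloring R (G n) (c n))[mono_copies_rv R (star r) (G n) (c n)]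
          @[n --> \oo] --> lambda%:E)%E))
  /\
  (forall H : sgraph,
      connected_graph H ->
      (2 <= #|H|)%N ->
      ~ is_star H ->
      exists (G : nat -> sgraph) (c : nat -> nat),
        [/\ #|G n| @[n --> \oo] --> \oo,
            forall n, (0 < c n)%N,
            c n @[n --> \oo] --> \oo,
            cvg_in_distribution
              (fun n => mono_copies_rv R H (G n) (c n)) (poisson_rv lambda) &
            ~ (('E_(uniform_coloring R (G n) (c n))[mono_copies_rv R H (G n) (c n)]
                  @[n --> \oo] --> lambda%:E)%E /\
               ('V_(uniform_coloring R (G n) (c n))[mono_copies_rv R H (G n) (c n)]
                  @[n --> \oo] --> lambda%:E)%E)]).
Proof.
split=> [r G c r_gt0 _ _ c_cvg|H H_connected H_gt1 H_not_star].
  split=> [/(cvg_in_distributionP lambda_gt0) pcvg|].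
    have [m_cvg v_cvg] := stars_moments_cvg lambda_gt0 r_gt0 pcvg.
    by split; [exact/cvg_expectationP|exact/cvg_varianceP].
  move=> [/cvg_expectationP m_cvg /cvg_varianceP v_cvg].
  apply/(cvg_in_distributionP lambda_gt0).
  case: r r_gt0 m_cvg v_cvg => [//|[|r]] _ m_cvg v_cvg.
    exact: edges_poisson.
  exact: big_stars_poisson.
exists (gadget_seq lambda H), succn; split=> //.
- exact: card_gadget_seq_cvg.
- exact: succn_cvg.
- by apply/(cvg_in_distributionP lambda_gt0) => k; exact: gadget_seq_poisson.
- by move=> [/cvg_expectationP m_cvg _]; exact: (gadget_seq_mean H_gt1 m_cvg).
Qed.
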